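(* Let $G = S \ltimes X$ be an ample groupoid, where $S$ is an inverse semigroup acting on a totally disconnected locally compact Hausdorff space $X$, and let $U \colon E \to \mathcal O_c(X)$ be an $S$-equivariant generating representation of a semilattice $E$ by compact open subsets in $X$. Let $\mathscr R$ be a thorough $S$-invariant system of concrete finite covers in $E$ with respect to $U$. Then there is an independent resolution \[ \cdots \to G_k \to \cdots \to G_0 \to G \to \emptyset \] of $G$ such that for each $k \geq 0$, $G_k = S \ltimes X_k$ for an $S$-space $X_k$ admitting an $S$-invariant regular basis, and $G_{k+1} = \emptyset$ for all $k \geq \sup_{e \in E} \# \{F \in \mathscr R(e) \mid F \text{ non-trivial} \}$.
   Context: **Actions.** Inverse semigroups and semilattices have a $0$; $E^\times=E\setminus\{0\}$. An action of $S$ on a locally compact Hausdorff space $X$ is by partial homeomorphisms $s\colon\mathrm{dom}_X(s)\to\mathrm{ran}_X(s)$ between open subsets, compatible with products, with $\mathrm{dom}_X(0)=\emptyset$ and every point of $X$ in some $\mathrm{dom}_X(s)$. With $s\le t$ iff $s\in tE(S)$ ($E(S)$ the idempotents of $S$), $S\ltimes X=\{(s,x):x\in\mathrm{dom}_X(s)\}/\!\sim$, $(s,x)\sim(t,y)$ iff $x=y$ and there is $u\le s,t$ with $x\in\mathrm{dom}_X(u)$; $[s,x]$ has source $x$, range $s.x$, $[t,s.x][s,x]=[ts,x]$. An action of $S$ on a poset $E$ with $0$ is an action by order isomorphisms $\mathrm{dom}_E(s)\to\mathrm{ran}_E(s)$ between down-sets, restricting to an action on the set $E^\times$ (with $0\in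 S$ having empty domain there, and every element of $E^\times$ in some domain). **Representations.** $\mathcal O_c(X)$ is the set of compact open subsets. A representation of a semilattice $E$ on $X$ is a map $U\colon E\to\mathcal O_c(X)$ with $U(0)=\emptyset$ and $U(ef)=U(e)\cap U(f)$. It is generating if $\{U(e)\}$ generates $\mathcal O_c(X)$ under finite unions and relative complements $V\setminus W$, $W\subseteq V$. Given actions of $S$ on $X$ and $E$, it is $S$-equivariant if $\mathrm{dom}_X(s)=\bigcup_{e\in\mathrm{dom}_E(s)}U(e)$ and $s.(U(e))=U(s.e)$ for all $s \in S$, $e\in\mathrm{dom}_E(s)$. **Covers.** A finite cover of $e\in E$ is a finite set $F\subseteq E$ with $f\le e$ for all $f\in F$ such that, if $k\in E$ satisfies $kf=0$ for all $f\in F$, then $ke=0$. It is trivial if $e\in F$, and concrete (with respect to $U$) if $U(e)=\bigcup_{f\in F}U(f)$. For $k\le e$, $k\downarrow F$ is the set of maximal elements of $\{kf:f\in F\}$. A system of finite covers is a family $\mathscr R=(\mathscr R(e))_{e\in E}$ of sets of finite covers $F$ of $e$ such that $\{e\}\in\mathscr R(e)$ for all $e$, and $k\downarrow F\in\mathscr R(k)$ whenever $F\in\mathscr R(e)$, $k\le e$. It is $S$-invariant if $s.F=\{s.f:f\in F\}\in\mathscr R(s.e)$ whenever $e\in\mathrm{dom}_E(s)$, $F\in\mathscr R(e)$. A system of concrete finite covers is thorough if, whenever $U(e)\subseteq\bigcup_{i=1}^nU(e_i)$, there are a positive integer $N$ and covers $F(e)\in\mathscr R(e)$, $F(e,f_1)\in\mathscr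 R(f_1)$ for all $f_1\in F(e)$, $F(e,f_1,f_2)\in\mathscr R(f_2)$ for all $f_1\in F(e),f_2\in F(e,f_1)$, ..., $F(e,f_1,\dots,f_{N-1})\in\mathscr R(f_{N-1})$ for all $f_1\in F(e),\dots,f_{N-1}\in F(e,f_1,\dots,f_{N-2})$, such that for every chain $f_1\in F(e)$, $f_2\in F(e,f_1)$, ..., $f_N\in F(e,f_1,\dots,f_{N-1})$ there is an $i$ with $f_N\le e_i$. **Regular bases.** A regular basis of $X$ is a set $\mathcal U$ of nonempty compact open subsets such that $\mathcal U\cup\{\emptyset\}$ is closed under finite intersections, $\mathcal U$ generates $\mathcal O_c(X)$ under finite unions, finite intersections and relative complements, and $V\subseteq\bigcup_{i=1}^nV_i$ with $V,V_i\in\mathcal U$ implies $V\subseteq V_i$ for some $i$. It is $S$-invariant if for each $s \in S$ the set $\mathrm{dom}_X(s)$ is the union of the members of $\mathcal U$ contained in it, and $s.V\in\mathcal U$ for each such member $V$. **Locally finite weak semilattices.** A weak semilattice is a poset $L$ with least element $0$ such that for all $k,l\in L$ there is a finite set $A$ of common lower bounds of $k,l$ such that each common lower bound is $\le$ some element of $A$; $k\downarrow l$ is the finite set of maximal common lower bounds. It is locally finite if each finite subset lies in a finite subset closed under $\downarrow$ (i.e. containing $x\downarrow y$ for all its elements $x,y$). $\widehat L$ is the space (pointwise convergence) of nonzero maps $\chi\colon L\to\{0,1\}$ with $\chi(0)=0$ such that $\chi(k)=\chi(l)=1$ iff $\chi(m)=1$ for some $m\in k\downarrow l$. An action of $S$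 on $L$ (by order isomorphisms between down-sets) induces one on $\widehat L$: $\mathrm{dom}_{\widehat L}(s)=\{\chi:\chi(l)=1\text{ for some }l\in\mathrm{dom}_L(s)\}$, and $(s.\chi)(l)=1$ iff there is $k\in\mathrm{ran}_L(s)$, $k\le l$, with $\chi(s^{-1}.k)=1$. **Independent resolutions.** An independent resolution of an ample groupoid $G$ is a sequence of ample groupoids $G_i$, $i\ge-1$, with $G_{-1}=G$; decompositions $G_i^0=C_i\amalg O_i$ with $C_i$ closed and $G_i$-invariant, where $O_{-1}=G^0$; groupoid isomorphisms $G_i|_{O_i}\cong G_{i+1}|_{C_{i+1}}$ for all $i\ge-1$; and, for each $i\ge0$, an action $S_i\curvearrowright L_i$ of an inverse semigroup on a locally finite weak semilattice and an isomorphism $G_i\cong S_i\ltimes\widehat{L_i}$. *)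

(* Defs.v *)
From HB Require Import structures.
From mathcomp Require Import all_boot all_order.
From mathcomp Require Import all_classical topology function_spaces.

Set Implicit Arguments.
Unset Strict Implicit.
Unset Printing Implicit Defensive.

Import Order.TTheory.
Local Open Scope group_scope.
Local Open Scope quotient_scope.
Local Open Scope classical_set_scope.

HB.mixin Record Semigroup_isInverse0 S of Semigroup S := {
  sinv : S -> S;
  szero : S;
  mulsVs : forall s : S, s * sinv s * s = s;
  mulVsV : forall s : S, sinv s * s * sinv s = sinv s;
  sinv_uniq : forall s t : S, s * t * s = s -> t * s * t = t -> t = sinv s;
  mul0s : forall s : S, szero * s = szero;
  muls0 : forall s : S, s * szero = szero
}.

#[short(type="invSemigroupType")]
HB.structure Definition InvSemigroup :=
  {S of Semigroup_isInverse0 S & Semigroup S}.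

Section InvSemigroupTheory.
Variable S : invSemigroupType.
Implicit Types s t u e f : S.

Definition idem e := e * e = e.

(* The natural partial order: s \in t E(S). *)
Definition sle s t := exists2 e, idem e & s = t * e.

Lemma idemVs s : idem (sinv s * s).
Proof. by rewrite /idem mulgA mulVsV. Qed.

Lemma idemsV s : idem (s * sinv s).
Proof. by rewrite /idem mulgA mulsVs. Qed.

Lemma sinv_idem e : idem e -> sinv e = e.
Proof. by move=> ee; apply/esym/sinv_uniq; rewrite !ee. Qed.

Lemma sinvK s : sinv (sinv s) = s.
Proof. by apply/esym/sinv_uniq; rewrite ?mulsVs ?mulVsV. Qed.

Lemma idemM e f : idem e -> idem f -> idem (e * f).
Proof.
move=> ee ff; pose x := sinv (e * f).
have xE : x = f * x * e.
  apply/esym/sinv_uniq.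
    have := mulsVs (e * f); rewrite -/x !mulgA => {2}<-.
    by rewrite -!mulgA (mulgA f f) ff !mulgA -(mulgA _ e e) ee.
  rewrite -!mulgA (mulgA e e) ee (mulgA f f) ff.
  have := mulVsV (e * f); rewrite -/x -!mulgA => E.
  by rewrite -[in RHS]E !mulgA.
have xx : idem x.
  rewrite /idem {1}xE [X in _ * X = _]xE.
  have := mulVsV (e * f); rewrite -/x -!mulgA => E.
  by rewrite [RHS]xE -[in RHS]E !mulgA.
have : e * f = x by rewrite -[LHS]sinvK -/x (sinv_idem xx).
by move=> ->.
Qed.

Lemma idemC e f : idem e -> idem f -> e * f = f * e.
Proof.
move=> ee ff; have ef := idemM ee ff; have fe := idemM ff ee.
rewrite -[LHS](sinv_idem ef); apply/esym/sinv_uniq.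
  by rewrite -!mulgA (mulgA f f) ff (mulgA e e) ee !mulgA -[RHS]ef !mulgA.
by rewrite -!mulgA (mulgA e e) ee (mulgA f f) ff !mulgA -[RHS]fe !mulgA.
Qed.

Lemma idem_swap s e : idem e -> e * s = s * (sinv s * e * s).
Proof.
by move=> ee; rewrite !mulgA (idemC (idemsV s) ee) -(mulgA e) mulsVs.
Qed.

Lemma idem_conj s e : idem e -> idem (sinv s * e * s).
Proof.
move=> ee; rewrite /idem -(mulgA (sinv s * e) s) -(idem_swap s ee).
by rewrite -mulgA (mulgA e e) ee mulgA.
Qed.

Lemma sle_refl s : sle s s.
Proof. by exists (sinv s * s); [exact: idemVs|rewrite mulgA mulsVs]. Qed.

Lemma sle_mulr s e : idem e -> sle (s * e) s.
Proof. by exists e. Qed.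

Lemma sle_mull s e : idem e -> sle (e * s) s.
Proof.
by move=> ee; rewrite (idem_swap s ee); apply: sle_mulr; exact: idem_conj.
Qed.

Lemma sleM s s' t t' : sle s s' -> sle t t' -> sle (s * t) (s' * t').
Proof.
move=> [e ee ->] [f ff ->]; exists (sinv t' * e * t' * f).
  by apply: idemM => //; exact: idem_conj.
by rewrite (mulgA (s' * e)) -(mulgA s' e) (idem_swap t' ee) !mulgA.
Qed.

End InvSemigroupTheory.

(* A homomorphism from [S] to the inverse semigroup of partial bijections of
   [T].  The values of [act s] outside [dom s] are junk. *)
Record partial_action (S : invSemigroupType) (T : Type) := PartialAction {
  dom : S -> set T;
  act : S -> T -> T;
  act_inj : forall s, {in dom s &, injective (act s)};
  dom_mul : forall s t, dom (s * t) = dom t `&` act t @^-1` dom s;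
  act_mul : forall s t x, dom (s * t) x -> act (s * t) x = act s (act t x)
}.

Definition ran (S : invSemigroupType) (T : Type) (a : partial_action S T)
  (s : S) : set T := act a s @` dom a s.

(* [f] restricts to a homeomorphism between the open sets [D] and [f @` D]. *)
Definition partial_homeo (X Y : topologicalType) (D : set X) (f : X -> Y) :=
  [/\ open D, open (f @` D), {within D, continuous f} &
      exists2 g : Y -> X, {in D, cancel f g} &
        {within f @` D, continuous g}].

Record space_action (S : invSemigroupType) (X : topologicalType) :=
  SpaceAction {
  space_act :> partial_action S X;
  space_homeo : forall s, partial_homeo (dom space_act s) (act space_act s);
  space_dom0 : dom space_act (szero : S) = set0;
  space_cover : forall x, exists s, dom space_act s x
}.

(* An order isomorphism between nonempty down-sets fixes [\bot], so such an
   action automatically restricts to the nonzero elements; the last two fields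
   say that the restriction is an action. *)
Record poset_action (S : invSemigroupType) (d : Order.disp_t)
  (E : bPOrderType d) := PosetAction {
  poset_act :> partial_action S E;
  poset_dom_down : forall s x y,
    (y <= x)%O -> dom poset_act s x -> dom poset_act s y;
  poset_ran_down : forall s x y,
    (y <= x)%O -> ran poset_act s x -> ran poset_act s y;
  poset_mono : forall s,
    {in dom poset_act s &, {mono act poset_act s : x y / (x <= y)%O}};
  poset_dom0 : forall x, dom poset_act (szero : S) x -> x = \bot%O;
  poset_cover : forall x, x <> \bot%O -> exists s, dom poset_act s x
}.

(* The value of [gmul g h] is meaningful only when [src g = rng h]. *)
Record groupoid := Groupoid {
  gobj : topologicalType;
  garr : topologicalType;
  src : garr -> gobj;
  rng : garr -> gobj;
  gone : gobj -> garr;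
  ginv : garr -> garr;
  gmul : garr -> garr -> garr;
  src_one : forall x, src (gone x) = x;
  rng_one : forall x, rng (gone x) = x;
  src_inv : forall g, src (ginv g) = rng g;
  rng_inv : forall g, rng (ginv g) = src g;
  src_mul : forall g h, src g = rng h -> src (gmul g h) = src h;
  rng_mul : forall g h, src g = rng h -> rng (gmul g h) = rng g;
  gmulA : forall g h k, src g = rng h -> src h = rng k ->
    gmul g (gmul h k) = gmul (gmul g h) k;
  gmul1g : forall g, gmul (gone (rng g)) g = g;
  gmulg1 : forall g, gmul g (gone (src g)) = g;
  gmulVg : forall g, gmul (ginv g) g = gone (src g);
  gmulgV : forall g, gmul g (ginv g) = gone (rng g)
}.

Definition topological_groupoid (G : groupoid) :=
  [/\ continuous (@src G), continuous (@rng G), continuous (@gone G),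
      continuous (@ginv G) &
      {within [set p : garr G * garr G | src p.1 = rng p.2],
        continuous (fun p : garr G * garr G => gmul p.1 p.2)}].

Definition local_homeo (X Y : topologicalType) (f : X -> Y) :=
  forall x, exists2 D : set X, D x & partial_homeo D f.

Definition tdlch (X : topologicalType) :=
  [/\ hausdorff_space X, locally_compact [set: X] &
      totally_disconnected [set: X]].

(* The arrow space of an ample groupoid need not be Hausdorff. *)
Definition ample (G : groupoid) :=
  [/\ topological_groupoid G, local_homeo (@src G) & tdlch (gobj G)].

Definition homeomorphism (X Y : topologicalType) (f : X -> Y) :=
  continuous f /\
  exists g : Y -> X, [/\ continuous g, cancel f g & cancel g f].

Definition isomorphic (G H : groupoid) :=
  exists (f0 : gobj G -> gobj H) (f1 : garr G -> garr H),
    [/\ homeomorphism f0, homeomorphism f1,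
        (forall g, src (f1 g) = f0 (src g)),
        (forall g, rng (f1 g) = f0 (rng g)) &
        forall g h, src g = rng h -> f1 (gmul g h) = gmul (f1 g) (f1 h)].

Definition ginvariant (G : groupoid) (A : set (gobj G)) :=
  forall g : garr G, A (src g) <-> A (rng g).

Section Restriction.
Variables (G : groupoid) (A : set (gobj G)).

Definition reduction : set (garr G) := [set g | A (src g) /\ A (rng g)].

Definition restrict_src (g : reduction) : A :=
  exist _ (src (val g)) (mem_set (proj1 (set_mem (valP g)))).

Definition restrict_rng (g : reduction) : A :=
  exist _ (rng (val g)) (mem_set (proj2 (set_mem (valP g)))).

Lemma restrict_one_subproof (x : A) : reduction (gone (val x)).
Proof.
by rewrite /reduction /= src_one rng_one; split; exact: (set_mem (valP x)).
Qed.

Definition restrict_one (x : A) : reduction :=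
  exist _ (gone (val x)) (mem_set (restrict_one_subproof x)).

Lemma restrict_inv_subproof (g : reduction) : reduction (ginv (val g)).
Proof.
by rewrite /reduction /= src_inv rng_inv; have [] := set_mem (valP g).
Qed.

Definition restrict_inv (g : reduction) : reduction :=
  exist _ (ginv (val g)) (mem_set (restrict_inv_subproof g)).

Definition restrict_mul (g h : reduction) : reduction :=
  insubd g (gmul (val g) (val h)).

Lemma val_restrict_mul (g h : reduction) : restrict_src g = restrict_rng h ->
  val (restrict_mul g h) = gmul (val g) (val h).
Proof.
move=> /(congr1 val) /= gh; rewrite val_insubd ifT//; apply/mem_set.
rewrite /reduction /= (src_mul gh) (rng_mul gh).
by have [_ ?] := set_mem (valP g); have [? _] := set_mem (valP h).
Qed.

Lemma restrict_src_mul (g h : reduction) : restrict_src g = restrict_rng h ->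
  restrict_src (restrict_mul g h) = restrict_src h.
Proof.
move=> gh; apply: val_inj; rewrite /= val_restrict_mul// src_mul//.
by move/(congr1 val): gh.
Qed.

Lemma restrict_rng_mul (g h : reduction) : restrict_src g = restrict_rng h ->
  restrict_rng (restrict_mul g h) = restrict_rng g.
Proof.
move=> gh; apply: val_inj; rewrite /= val_restrict_mul// rng_mul//.
by move/(congr1 val): gh.
Qed.

Definition grestrict : groupoid.
Proof.
refine (@Groupoid A reduction restrict_src restrict_rng restrict_one
  restrict_inv restrict_mul _ _ _ _ restrict_src_mul restrict_rng_mul
  _ _ _ _ _).
- by move=> x; apply: val_inj; rewrite /= src_one.
- by move=> x; apply: val_inj; rewrite /= rng_one.
- by move=> g; apply: val_inj; rewrite /= src_inv.
- by move=> g; apply: val_inj; rewrite /= rng_inv.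
- move=> g h k gh hk; apply: val_inj.
  rewrite !val_restrict_mul ?restrict_src_mul ?restrict_rng_mul//.
  by rewrite gmulA//; [move/(congr1 val): gh|move/(congr1 val): hk].
- move=> g; apply: val_inj; rewrite val_restrict_mul/= ?gmul1g//.
  by apply: val_inj; rewrite /= src_one.
- move=> g; apply: val_inj; rewrite val_restrict_mul/= ?gmulg1//.
  by apply: val_inj; rewrite /= rng_one.
- move=> g; apply: val_inj; rewrite val_restrict_mul/= ?gmulVg//.
  by apply: val_inj; rewrite /= src_inv.
- move=> g; apply: val_inj; rewrite val_restrict_mul/= ?gmulgV//.
  by apply: val_inj; rewrite /= rng_inv.
Defined.

End Restriction.

Section GermGroupoid.
Variables (S : invSemigroupType) (X : topologicalType) (a : space_action S X).

(* The pairs (s, x) with x in dom(s), as the topological disjoint union of the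
   open sets dom(s) (so [S] is discrete). *)
Definition germ_pair := {s : S & set_type (dom a s)}.

Definition mk_pair s x (sx : dom a s x) : germ_pair :=
  existT _ s (exist _ x (mem_set sx)).

Definition germ_fst (p : germ_pair) : S := tag p.
Definition germ_snd (p : germ_pair) : X := val (tagged p).

Definition germ_eqv (p q : germ_pair) :=
  germ_snd p = germ_snd q /\
  exists u, [/\ sle u (germ_fst p), sle u (germ_fst q) & dom a u (germ_snd p)].

Lemma germ_sndP p : dom a (germ_fst p) (germ_snd p).
Proof. exact: (set_mem (valP (tagged p))). Qed.

Lemma idem_fix e x : idem e -> dom a e x -> act a e x = x.
Proof.
move=> ee ex; have : dom a (e * e) x by rewrite ee.
move=> eex; have := eex; rewrite dom_mul => -[_ /= eax].
apply: (act_inj (p := a) (s := e)); [exact: mem_set|exact: mem_set|].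
by rewrite -(act_mul eex) ee.
Qed.

Lemma domMr s e x : idem e -> dom a s x -> dom a e x -> dom a (s * e) x.
Proof. by move=> ee sx ex; rewrite dom_mul; split=> //=; rewrite (idem_fix ee ex). Qed.

Lemma dom_mulr s e x : idem e -> dom a (s * e) x -> dom a s x /\ dom a e x.
Proof.
by move=> ee; rewrite dom_mul => -[ex /=]; rewrite (idem_fix ee ex).
Qed.

Lemma dom_sle s t x : sle s t -> dom a s x -> dom a t x.
Proof. by move=> [e ee ->] /(dom_mulr ee)[]. Qed.

Lemma act_sle s t x : sle s t -> dom a s x -> act a s x = act a t x.
Proof.
by move=> [e ee ->] sx; have [_ ex] := dom_mulr ee sx;
  rewrite (act_mul sx) (idem_fix ee ex).
Qed.

Lemma act_dom_inv s x : dom a s x -> dom a (sinv s) (act a s x).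
Proof.
rewrite -{1}(mulsVs s) -mulgA dom_mul => -[+ _].
by rewrite dom_mul => -[_].
Qed.

Lemma domVs s x : dom a s x -> dom a (sinv s * s) x.
Proof. by move=> sx; rewrite dom_mul; split=> //; exact: act_dom_inv. Qed.

Lemma act_invK s x : dom a s x -> act a (sinv s) (act a s x) = x.
Proof.
move=> sx; have ssx := domVs sx.
by rewrite -(act_mul ssx) (idem_fix (idemVs s) ssx).
Qed.

Lemma germ_eqv_refl p : germ_eqv p p.
Proof.
by split=> //; exists (germ_fst p); split;
  [exact: sle_refl|exact: sle_refl|exact: germ_sndP].
Qed.

Lemma germ_eqv_sym p q : germ_eqv p q -> germ_eqv q p.
Proof. by move=> [xy [u [up uq ux]]]; split=> //; exists u; rewrite -xy. Qed.

Lemma germ_eqv_trans q p r : germ_eqv p q -> germ_eqv q r -> germ_eqv p r.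
Proof.
move=> [xy [u [up uq ux]]] [yz [v [vq vr vx]]]; split; first by rewrite xy.
rewrite -xy in vx.
case: uq => e ee uE; case: vq => f ff vE; exists (u * f).
have ex : dom a e (germ_snd p) by move: ux; rewrite uE => /(dom_mulr ee)[].
have fx : dom a f (germ_snd p) by move: vx; rewrite vE => /(dom_mulr ff)[].
split; last exact: domMr.
- case: up => g gg ->; exists (g * f); rewrite ?mulgA//; exact: idemM.
- rewrite uE -mulgA (idemC ee ff) mulgA -vE.
  by case: vr => g gg ->; exists (g * e); rewrite ?mulgA//; exact: idemM.
Qed.

Definition germ_rel : rel germ_pair := fun p q => `[< germ_eqv p q >].

Lemma germ_rel_equiv : equiv_class_of germ_rel.
Proof.
split=> [p|p q|q p r].
- exact/asboolP/germ_eqv_refl.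
- by apply/asboolP/asboolP => /germ_eqv_sym.
- by move=> /asboolP pq /asboolP qr; apply/asboolP; exact: germ_eqv_trans qr.
Qed.

Canonical germ_equiv := EquivRelPack germ_rel_equiv.

Definition germ : topologicalType :=
  quotient_topology {eq_quot germ_rel}.

Definition to_germ (p : germ_pair) : germ := \pi_{eq_quot germ_rel} p.

Definition of_germ (g : germ) : germ_pair := repr (g : {eq_quot germ_rel}).

Lemma of_germK g : to_germ (of_germ g) = g.
Proof. exact: reprK. Qed.

Lemma to_germP p q : to_germ p = to_germ q <-> germ_eqv p q.
Proof.
split=> [pq|pq]; first exact/asboolP/(@eqmodP _ germ_equiv).
exact/(@eqmodP _ germ_equiv)/asboolP.
Qed.

Lemma to_germK p : germ_eqv (of_germ (to_germ p)) p.
Proof. by apply/to_germP; rewrite of_germK. Qed.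

Definition germ_src (g : germ) : X := germ_snd (of_germ g).

Definition germ_rng (g : germ) : X :=
  act a (germ_fst (of_germ g)) (germ_snd (of_germ g)).

Lemma germ_one_subproof x :
  dom a (sinv (projT1 (cid (space_cover a x))) *
         projT1 (cid (space_cover a x))) x.
Proof. by case: cid => s /= sx; exact: domVs. Qed.

(* [e, x] for some idempotent e with x in dom(e); the germ does not depend on
   the choice of e. *)
Definition germ_one (x : X) : germ := to_germ (mk_pair (germ_one_subproof x)).

Definition germ_inv (g : germ) : germ :=
  to_germ (mk_pair (act_dom_inv (germ_sndP (of_germ g)))).

Definition germ_mul (g h : germ) : germ :=
  let s := germ_fst (of_germ g) in let t := germ_fst (of_germ h) in
  if pselect (dom a (s * t) (germ_snd (of_germ h))) is left st
  then to_germ (mk_pair st) else g.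

Lemma germ_srcE p : germ_src (to_germ p) = germ_snd p.
Proof. by rewrite /germ_src; have [] := to_germK p. Qed.

Lemma germ_eqv_act p q : germ_eqv p q ->
  act a (germ_fst p) (germ_snd p) = act a (germ_fst q) (germ_snd q).
Proof.
move=> [xy [u [up uq ux]]]; rewrite -(act_sle up ux) xy (act_sle uq)//.
by rewrite -xy.
Qed.

Lemma germ_rngE p :
  germ_rng (to_germ p) = act a (germ_fst p) (germ_snd p).
Proof. exact/germ_eqv_act/to_germK. Qed.

Lemma germ_mulE p q (pq : dom a (germ_fst p * germ_fst q) (germ_snd q)) :
  germ_snd p = act a (germ_fst q) (germ_snd q) ->
  germ_mul (to_germ p) (to_germ q) = to_germ (mk_pair pq).
Proof.
move=> pqE; rewrite /germ_mul.
have [yE [v [vp' vp vy]]] := to_germK p.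
have [xE [u [uq' uq ux]]] := to_germK q.
set p' := of_germ _ in yE vp' vy *; set q' := of_germ _ in xE uq' ux *.
have vux : dom a (v * u) (germ_snd q').
  rewrite dom_mul; split=> //=; move: vy; rewrite yE pqE.
  by rewrite (act_sle uq ux) xE.
case: pselect => [pq'|[]]; last by apply: dom_sle vux; exact: sleM.
apply/to_germP; split=> //; exists (v * u); split=> //; exact: sleM.
Qed.

Lemma to_germ_eq (p q : germ_pair) u : germ_snd p = germ_snd q ->
  sle u (germ_fst p) -> sle u (germ_fst q) -> dom a u (germ_snd p) ->
  to_germ p = to_germ q.
Proof. by move=> xy up uq ux; apply/to_germP; split=> //; exists u. Qed.

Lemma germ_ind (P : germ -> Prop) : (forall p, P (to_germ p)) -> forall g, P g.
Proof. by move=> H g; rewrite -(of_germK g). Qed.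

Lemma dom_comp p q : germ_snd p = act a (germ_fst q) (germ_snd q) ->
  dom a (germ_fst p * germ_fst q) (germ_snd q).
Proof.
by move=> pq; rewrite dom_mul; split=> /=; [|rewrite -pq]; exact: germ_sndP.
Qed.

Lemma germ_oneE e x (ex : dom a e x) : idem e ->
  to_germ (mk_pair ex) = germ_one x.
Proof.
move=> ee; apply: (@to_germ_eq _ _
    (e * germ_fst (mk_pair (germ_one_subproof x)))) => //=.
- by apply: sle_mulr; exact: idemVs.
- by apply: sle_mull.
- by apply: domMr; [exact: idemVs|exact: ex|exact: germ_one_subproof].
Qed.

Lemma germ_oneP x : exists2 p, germ_one x = to_germ p &
  idem (germ_fst p) /\ germ_snd p = x.
Proof.
by exists (mk_pair (germ_one_subproof x)) => //; split=> //; exact: idemVs.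
Qed.

Lemma germ_src_one x : germ_src (germ_one x) = x.
Proof. by rewrite germ_srcE. Qed.

Lemma germ_rng_one x : germ_rng (germ_one x) = x.
Proof.
by rewrite germ_rngE /= (idem_fix (idemVs _))//; exact: germ_one_subproof.
Qed.

Lemma germ_src_inv g : germ_src (germ_inv g) = germ_rng g.
Proof. by rewrite germ_srcE. Qed.

Lemma germ_rng_inv g : germ_rng (germ_inv g) = germ_src g.
Proof. by rewrite germ_rngE /= act_invK//; exact: germ_sndP. Qed.

Lemma germ_src_mul g h : germ_src g = germ_rng h ->
  germ_src (germ_mul g h) = germ_src h.
Proof.
elim/germ_ind: g => p; elim/germ_ind: h => q.
rewrite germ_srcE germ_rngE => pq.
by rewrite (germ_mulE (dom_comp pq) pq) !germ_srcE.
Qed.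

Lemma germ_rng_mul g h : germ_src g = germ_rng h ->
  germ_rng (germ_mul g h) = germ_rng g.
Proof.
elim/germ_ind: g => p; elim/germ_ind: h => q.
rewrite germ_srcE germ_rngE => pq; have pqd := dom_comp pq.
by rewrite (germ_mulE pqd pq) !germ_rngE /= (act_mul pqd) pq.
Qed.

Lemma germ_mulA g h k : germ_src g = germ_rng h -> germ_src h = germ_rng k ->
  germ_mul g (germ_mul h k) = germ_mul (germ_mul g h) k.
Proof.
elim/germ_ind: g => p; elim/germ_ind: h => q; elim/germ_ind: k => r.
rewrite !germ_srcE !germ_rngE => pq qr.
have pqd := dom_comp pq; have qrd := dom_comp qr.
rewrite (germ_mulE pqd pq) (germ_mulE qrd qr).
have p_qr : germ_snd p =
    act a (germ_fst (mk_pair qrd)) (germ_snd (mk_pair qrd)).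
  by rewrite pq qr /= (act_mul qrd).
have pq_r : germ_snd (mk_pair pqd) = act a (germ_fst r) (germ_snd r) by [].
rewrite (germ_mulE (dom_comp p_qr) p_qr) (germ_mulE (dom_comp pq_r) pq_r).
apply: (to_germ_eq (u := germ_fst p * (germ_fst q * germ_fst r))) => //=.
- exact: sle_refl.
- by rewrite /germ_fst /= mulgA; exact: sle_refl.
- exact: (dom_comp p_qr).
Qed.

Lemma germ_mul1g g : germ_mul (germ_one (germ_rng g)) g = g.
Proof.
elim/germ_ind: g => q; have [p -> [ee xE]] := germ_oneP (germ_rng (to_germ q)).
rewrite germ_rngE in xE; have pqd := dom_comp xE; rewrite (germ_mulE pqd xE).
apply: (to_germ_eq (u := germ_fst p * germ_fst q)) => //=.
- exact: sle_refl.
- exact: sle_mull.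
Qed.

Lemma germ_mulg1 g : germ_mul g (germ_one (germ_src g)) = g.
Proof.
elim/germ_ind: g => p; have [q -> [ee xE]] := germ_oneP (germ_src (to_germ p)).
rewrite germ_srcE in xE.
have pq : germ_snd p = act a (germ_fst q) (germ_snd q).
  by rewrite (idem_fix ee) ?xE//; rewrite -xE; exact: germ_sndP.
have pqd := dom_comp pq; rewrite (germ_mulE pqd pq).
apply: (to_germ_eq (u := germ_fst p * germ_fst q)) => //=.
- exact: sle_refl.
- exact: sle_mulr.
Qed.

Lemma germ_mulVg g : germ_mul (germ_inv g) g = germ_one (germ_src g).
Proof.
rewrite -[in RHS](of_germK g) germ_srcE /germ_inv; set p := of_germ g.
have pq : germ_snd (mk_pair (act_dom_inv (germ_sndP p))) =
  act a (germ_fst p) (germ_snd p) by [].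
rewrite -[X in germ_mul _ X](of_germK g) -/p (germ_mulE (dom_comp pq) pq).
by apply: germ_oneE; exact: idemVs.
Qed.

Lemma germ_mulgV g : germ_mul g (germ_inv g) = germ_one (germ_rng g).
Proof.
rewrite -[in RHS](of_germK g) germ_rngE /germ_inv; set p := of_germ g.
have pq : germ_snd p =
  act a (germ_fst (mk_pair (act_dom_inv (germ_sndP p))))
    (germ_snd (mk_pair (act_dom_inv (germ_sndP p)))).
  by rewrite /= act_invK//; exact: germ_sndP.
rewrite -[X in germ_mul X _](of_germK g) -/p (germ_mulE (dom_comp pq) pq).
by apply: germ_oneE; exact: idemsV.
Qed.

Definition germ_groupoid : groupoid :=
  Groupoid germ_src_one germ_rng_one germ_src_inv germ_rng_inv
    germ_src_mul germ_rng_mul germ_mulA germ_mul1g germ_mulg1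
    germ_mulVg germ_mulgV.

End GermGroupoid.

Definition maximals (d : Order.disp_t) (L : porderType d) (A : set L) : set L :=
  [set m | A m /\ forall x, A x -> (m <= x)%O -> x = m].

Definition cpt_opens (X : topologicalType) : set (set X) :=
  [set V | open V /\ compact V].

Definition rel_compl_closed (X : Type) (M : set (set X)) :=
  forall V W, M V -> M W -> W `<=` V -> M (V `\` W).

Definition fin_union_closed (X : Type) (M : set (set X)) :=
  M set0 /\ setU_closed M.

Section Representation.
Variables (X : topologicalType) (d : Order.disp_t) (E : bMeetSemilatticeType d).

Definition representation (U : E -> set X) :=
  [/\ forall e, cpt_opens (U e), U \bot%O = set0 &
      forall e f, U (Order.meet e f) = U e `&` U f].

Definition generating (U : E -> set X) :=
  smallest (fun M => fin_union_closed M /\ rel_compl_closed M) (range U) =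
  @cpt_opens X.

Definition equivariant (S : invSemigroupType) (aX : space_action S X)
    (aE : poset_action S E) (U : E -> set X) := forall s,
  dom aX s = \bigcup_(e in dom aE s) U e /\
  forall e, dom aE s e -> act aX s @` U e = U (act aE s e).

Definition finite_cover (e : E) (F : set E) :=
  [/\ finite_set F, forall f, F f -> (f <= e)%O &
      forall k, (forall f, F f -> Order.meet k f = \bot%O) ->
        Order.meet k e = \bot%O].

Definition concrete (U : E -> set X) (e : E) (F : set E) :=
  U e = \bigcup_(f in F) U f.

Definition cover_down (k : E) (F : set E) : set E :=
  maximals [set Order.meet k f | f in F].

Definition cover_system (R : E -> set (set E)) :=
  [/\ forall e F, R e F -> finite_cover e F,
      forall e, R e [set e] &
      forall e k F, R e F -> (k <= e)%O -> R k (cover_down k F)].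

Definition invariant_system (S : invSemigroupType) (aE : poset_action S E)
    (R : E -> set (set E)) :=
  forall s e F, dom aE s e -> R e F -> R (act aE s e) (act aE s @` F).

(* A choice of covers F(e, f_1, ..., f_j) is coded by a function of the
   sequence [:: f_1; ...; f_j]; only its values on chains matter. *)
Definition cover_chain (F : seq E -> set E) (e : E) (fs : seq E) :=
  forall j, (j < size fs)%N -> F (take j fs) (nth e fs j).

Definition thorough (U : E -> set X) (R : E -> set (set E)) :=
  forall (e : E) (n : nat) (es : 'I_n.+1 -> E),
  U e `<=` \bigcup_(i : 'I_n.+1) U (es i) ->
  exists (N : nat) (F : seq E -> set E),
    [/\ (0 < N)%N,
        forall fs, (size fs < N)%N -> cover_chain F e fs ->
          R (last e fs) (F fs) &
        forall fs, size fs = N -> cover_chain F e fs ->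
          exists i, (last e fs <= es i)%O].

Definition nontrivial_covers (R : E -> set (set E)) (e : E) : set (set E) :=
  [set F | R e F /\ ~ F e].

End Representation.

Definition regular_basis (X : topologicalType) (B : set (set X)) :=
  [/\ forall V, B V -> cpt_opens V /\ V !=set0,
      setI_closed (B `|` [set set0]),
      smallest (fun M => [/\ fin_union_closed M, setI_closed M &
        rel_compl_closed M]) B = @cpt_opens X &
      forall (V : set X) (n : nat) (W : 'I_n -> set X),
        B V -> (forall i, B (W i)) -> V `<=` \bigcup_(i : 'I_n) W i ->
        exists i, V `<=` W i].

Definition invariant_basis (S : invSemigroupType) (X : topologicalType)
    (a : space_action S X) (B : set (set X)) := forall s,
  dom a s = \bigcup_(V in [set V | B V /\ V `<=` dom a s]) V /\
  forall V, B V -> V `<=` dom a s -> B (act a s @` V).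

Section WeakSemilattice.
Variables (d : Order.disp_t) (L : bPOrderType d).

Definition lower_bounds (k l : L) : set L :=
  [set m | (m <= k)%O /\ (m <= l)%O].

Definition weak_semilattice := forall k l : L, exists A : set L,
  [/\ finite_set A, A `<=` lower_bounds k l &
      forall m, lower_bounds k l m -> exists2 x, A x & (m <= x)%O].

Definition wmeet (k l : L) : set L := maximals (lower_bounds k l).

Definition locally_finite := forall A : set L, finite_set A ->
  exists B : set L, [/\ finite_set B, A `<=` B &
    forall x y, B x -> B y -> wmeet x y `<=` B].

Definition is_character (chi : L -> bool) :=
  [/\ exists l, chi l, chi \bot%O = false &
      forall k l, (chi k /\ chi l) <-> exists2 m, wmeet k l m & chi m].

Definition character_space : topologicalType :=
  set_type [set chi : {ptws L -> bool} | is_character chi].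

Definition char_val (chi : character_space) : L -> bool := val chi.

Definition induced_action (S : invSemigroupType) (aL : poset_action S L)
    (a : space_action S character_space) := forall s,
  dom a s = [set chi | exists2 l, dom aL s l & char_val chi l] /\
  forall chi, dom a s chi -> forall l,
    char_val (act a s chi) l <-> exists k, [/\ ran aL s k, (k <= l)%O &
      char_val chi (act aL (sinv s) k)].

End WeakSemilattice.

(* [G] is the groupoid of index -1, with [O_{-1}] all of its unit space, and
   [Gs i] the groupoid of index [i]. *)
Definition independent_resolution (G : groupoid) (Gs : nat -> groupoid) :=
  [/\ ample G, (forall i, ample (Gs i)),
      (exists C O : forall i, set (gobj (Gs i)),
        [/\ forall i, closed (C i) /\ ginvariant (C i),
            forall i, C i `|` O i = setT /\ C i `&` O i = set0,
            isomorphic (grestrict [set: gobj G]) (grestrict (C 0)) &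
            forall i, isomorphic (grestrict (O i)) (grestrict (C i.+1))]) &
      forall i, exists (S : invSemigroupType) (d : Order.disp_t)
        (L : bPOrderType d) (aL : poset_action S L)
        (a : space_action S (character_space L)),
        [/\ weak_semilattice L, locally_finite L, induced_action aL a &
            isomorphic (Gs i) (germ_groupoid a)]].

(* Main.v *)
Require Import Defs.
From HB Require Import structures.
From mathcomp Require Import finmap.
From mathcomp Require Import all_boot all_order.
From mathcomp Require Import all_classical topology function_spaces.

Set Implicit Arguments.
Unset Strict Implicit.
Unset Printing Implicit Defensive.

Import Order.TTheory.
Local Open Scope group_scope.
Local Open Scope classical_set_scope.
Local Open Scope card_scope.

(** A character of a semilattice [E] is the same thing as a proper filter of [E].
    The space of characters carries the basis of the sets [cyl e] of characters
    containing [e], and this basis is independent: [cyl e] contains the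
    principal filter of [e], which lies in [cyl f] only when [e <= f]. So
    characters give groupoids with a regular basis for free, and the theorem
    measures how far the given space [X] is from a space of characters.

    A point [x] of [X] gives the character [fun e => x \in U e]. The characters
    of this form are the covered ones, those which contain a member of [F] as
    soon as they contain [e] and [F] covers [e]: by compactness, a character
    that does not come from a point contains some [e], and none of finitely
    many [e_i], with [U e] inside the union of the [U e_i]; thoroughness then
    leads from [e] down through covers to elements below some [e_i], which a
    covered character has to follow ([covered_point]). This identifies the
    groupoid of [X] with the reduction of the groupoid of characters to a closed
    invariant set ([covered_iso]).

    The complementary open set is the union of the gaps, the sets of characters
    that contain [e] and no member of a cover [F] of [e]. Their finite
    intersections, also called gaps below, form a semilattice, and a gap can be
    cut down to a smaller cylinder because a cover can be restricted to a smaller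
    element. Each nonempty gap has a root [e]: the principal filter of [e]
    belongs to it and is contained in its other members. A cover [F] of the root
    divides the gap into the characters avoiding [F] and those containing a given
    member of [F]. These divisions are concrete covers for the semilattice of
    gaps, and they are again thorough ([next_covering]): to refine a gap [P]
    inside a union of gaps, choose a gap [Q] of the union that contains the
    principal filter of the root of [P], and divide [P] along one of the covers
    that define [Q]. Each division settles one more of finitely many conditions,
    so this stops.

    The construction can therefore be iterated, which gives the resolution.
    It ends because the number of nontrivial covers drops: a gap rooted at [e]
    avoids some nontrivial cover [F] of [e], and dividing it along that [F]
    returns the whole gap ([next_nontrivial]). When only trivial covers
    remain, there are no gaps. *)

(** * Compact open neighborhoods in totally disconnected spaces *)

Section Topology.
Variable T : topologicalType.
Implicit Types (A B K W : set T) (D : set (set T)).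

Lemma compact_filtered_capI D K W : compact K -> open W ->
  D !=set0 -> (forall A, D A -> closed A /\ A `<=` K) ->
  (forall A B, D A -> D B -> D (A `&` B)) ->
  \bigcap_(A in D) A `<=` W -> exists2 A, D A & A `<=` W.
Proof.
move=> cK oW [A0 DA0] DK DI DW; apply: contrapT => noA.
have FF : Filter (filter_from D (fun A => A `\` W)).
  apply: filter_from_filter; first by exists A0.
  move=> A B DA DB; exists (A `&` B); first exact: DI.
  by move=> x [[? ?] ?].
have PF : ProperFilter (filter_from D (fun A => A `\` W)).
  apply: filter_from_proper => A DA; apply: contrapT => AW; apply: noA.
  exists A => // x Ax; apply: contrapT => Wx; apply: AW; by exists x.
have [|p [Kp clp]] := cK _ PF; first by exists A0 => // x [/(proj2 (DK _ DA0))].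
have cAp A : D A -> (A `\` W) p.
  move=> DA; have /closure_id-> : closed (A `\` W).
    by apply: closedI; [have [] := DK _ DA|exact: open_closedC].
  by move=> V Vp; apply: clp => //; exists A.
have [_ Wp] := cAp _ DA0; apply: Wp; apply: DW => A DA; by have [] := cAp _ DA.
Qed.

Lemma compact_separated A B : hausdorff_space T -> compact A -> compact B ->
  A `&` B = set0 ->
  exists V W, [/\ open V, open W, A `<=` V, B `<=` W & V `&` W = set0].
Proof.
move=> hT cA cB AB.
have sep x : A x -> exists2 N, nbhs x N & B `<=` ~` closure N.
  move=> Ax; have /compact_near_coveringP := cB.
  move=> /(_ (set T) (powerset_filter_from (nbhs x)) (fun N => ~` closure N)).
  case=> [y By|N [Nx _ [M NM]] H]; last first.
    by exists M; [exact: Nx|exact: H NM].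
  have xy : x != y.
    apply/eqP => xy; move: (conj Ax By) => /=.
    by rewrite xy -[_ /\ _]/((A `&` B) y) AB.
  move: hT; rewrite open_hausdorff => /(_ _ _ xy)[[V W]] /= [].
  rewrite !inE => Vx Wy [oV oW VW0].
  exists (W, [set N | N `<=` V]); first split => /=.
  - exact: open_nbhs_nbhs.
  - apply/near_powerset_filter_fromP; first by move=> ? ?; exact: subset_trans.
    by exists V => //; exact: open_nbhs_nbhs.
  move=> [z N] /= [Wz NV] /(_ W (open_nbhs_nbhs (conj oW Wz))) [t [/NV Vt Wt]].
  by move: (conj Vt Wt); rewrite -[_ /\ _]/((V `&` W) t) VW0.
have [->|/set0P B0] := eqVneq B set0.
  by exists setT, set0; split=> //; [exact: openT|exact: open0|rewrite setI0].
have PB := set_nbhs_pfilter B0.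
have /compact_near_coveringP := cA.
move=> /(_ (set T) (powerset_filter_from (set_nbhs B)) (fun N => ~` closure N)).
case=> [x Ax|N [NB _ [M NM]] H]; last first.
  have /set_nbhsP [W [oW BW WM]] := NB _ NM.
  exists (~` closure M), W; split => //.
  - exact/closed_openC/closed_closure.
  - exact: H.
  - by rewrite -subset0 => t [/= + /WM Mt]; apply; exact: subset_closure.
have [N /nbhs_interior Nx BN] := sep _ Ax.
exists (N°, [set V | V `<=` ~` closure N]); first split => /=.
- exact: Nx.
- apply/near_powerset_filter_fromP; first by move=> ? ?; exact: subset_trans.
  exists (~` closure N) => //; apply/set_nbhsP; exists (~` closure N); split=> //.
  exact/closed_openC/closed_closure.
move=> [z V] /= [Nz VN] /(_ _ Nz)[t [/VN + Nt]]; apply; exact: subset_closure.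
Qed.

(** In a compact Hausdorff set the intersection of the relatively clopen sets
    containing a point is connected, hence reduced to that point in the totally
    disconnected case; compactness then makes one of them small. The relatively
    clopen subsets of a compact [K] are encoded as the compact subsets with
    compact complement in [K], which avoids the subspace topology. *)
Lemma tdlch_basis (x : T) N : tdlch T -> nbhs x N ->
  exists V, [/\ open V, compact V, V x & V `<=` N].
Proof.
move=> [hT lT tT] Nx.
have [K Kx cK] : exists2 K, nbhs x K & compact K.
  by have := lT x Logic.I; rewrite withinET => -[K Kx []]; exists K.
pose D := [set A : set T | [/\ A x, A `<=` K, compact A & compact (K `\` A)]].
pose Q := \bigcap_(A in D) A.
have DcK : D K.
  split=> //; first exact: nbhs_singleton Kx.
  by rewrite setDv; exact: compact0.
have Dcl A : D A -> closed A by case=> _ _ cA _; exact: compact_closed.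
have DI A B : D A -> D B -> D (A `&` B).
  move=> DA DB; have [Ax AK cA cKA] := DA; have [Bx BK cB cKB] := DB; split=> //.
  - by move=> t [/AK].
  - exact: compact_closedI (Dcl _ DB).
  - by rewrite setDIr; exact: compactU.
have QK : Q `<=` K by move=> t; exact.
have clQ : closed Q by apply: closed_bigI => A; exact: Dcl.
have Qx : Q x by move=> A [].
have cQ : compact Q by exact: subclosed_compact QK.
(* A splitting of Q into two compact pieces extends to one of some A in D. *)
have Qsplit B1 B2 : compact B1 -> compact B2 -> B1 `&` B2 = set0 ->
    B1 `|` B2 = Q -> B1 x -> B2 = set0.
  move=> cB1 cB2 B0 BQ B1x.
  have [V [W [oV oW BV BW VW]]] := compact_separated hT cB1 cB2 B0.
  have [|||||A DA AVW] := @compact_filtered_capI D K (V `|` W) cK.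
  - exact: openU.
  - by exists K.
  - by move=> A DA; split; [exact: Dcl|have [] := DA].
  - exact: DI.
  - by rewrite -/Q -BQ; exact: setUSS.
  have [Ax AK cA cKA] := DA.
  have AVE : A `&` V = A `\` W.
    apply/seteqP; split=> t [At Vt]; split=> //.
      by move=> Wt; rewrite -[False]/(set0 t) -VW.
    by have [] := AVW _ At.
  have DAV : D (A `&` V).
    split.
    - by split => //; exact: BV.
    - by move=> t [/AK].
    - by rewrite AVE setDE; apply: compact_closedI => //; exact: open_closedC.
    - rewrite setDIr; apply: compactU => //.
      by rewrite setDE; apply: compact_closedI => //; exact: open_closedC.
  rewrite -subset0 => t B2t; rewrite -VW; split; last exact: BW.
  have Qt : Q t by rewrite -BQ; right.
  by have [] := Qt _ DAV.
have Qconn : connected Q.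
  move=> B [b Bb] [C oC BC] [C' cC' BC'].
  have cB : compact B by rewrite BC'; exact: compact_closedI.
  have cQB : compact (Q `\` B).
    rewrite BC setDIr setDv set0U setDE; apply: compact_closedI => //.
    exact: open_closedC.
  have BQ : B `<=` Q by rewrite BC => t [].
  have BQB0 : B `&` (Q `\` B) = set0 by rewrite -subset0 => t [Bt []].
  have [Bx|Bx] := pselect (B x).
    have := Qsplit _ _ cB cQB BQB0 (setDUK BQ) Bx.
    by rewrite setD_eq0 => QB; apply/seteqP; split.
  have := Qsplit _ _ cQB cB; rewrite setUC setDUK// setIC.
  by move=> /(_ BQB0 erefl (conj Qx Bx)) B0; move: Bb; rewrite B0.
have Q1 : Q `<=` [set x].
  by rewrite -(tT x Logic.I) => t Qt; exists Q.
have [|||||A DA AW] := @compact_filtered_capI D K (N° `&` K°) cK.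
- by apply: openI; exact: open_interior.
- by exists K.
- by move=> A DA; split; [exact: Dcl|have [] := DA].
- exact: DI.
- by move=> t /Q1 ->; split; exact: nbhs_singleton (nbhs_interior _).
have [Ax AK cA cKA] := DA; exists A; split=> //; last first.
  by move=> t /AW[/interior_subset].
have -> : A = K° `&` ~` (K `\` A).
  apply/seteqP; split=> t; first by move=> At; split; [have [] := AW _ At|move=> -[]].
  by move=> [/interior_subset Kt /not_andP[//|/contrapT]].
by apply: openI; [exact: open_interior|apply: closed_openC; exact: compact_closed].
Qed.

(** The filter used here is that of the finite subfamilies containing a given
    one; near-covering along it is the extraction of a finite subcover. *)
Lemma compact_cover_seq (I : choiceType) K (D : set I) (f : I -> set T) :
  compact K -> (forall i, D i -> open (f i)) -> K `<=` \bigcup_(i in D) f i ->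
  exists2 s : seq I, {in s, forall i, D i} & K `<=` \bigcup_(i in [set` s]) f i.
Proof.
move=> /compact_near_coveringP cK Do KD.
pose B (s : seq I) := [set t : seq I | {subset s <= t} /\ {in t, forall i, D i}].
have FB : Filter (filter_from [set s | {in s, forall i, D i}] B).
  apply: filter_from_filter; first by exists [::].
  move=> s t Ds Dt; exists (s ++ t) => [i|u [su Du]].
    by rewrite mem_cat => /orP[/Ds|/Dt].
  by split; split=> // i ui; apply: su; rewrite mem_cat ui ?orbT.
have [x Kx|s Ds sK] := cK _ _ (fun s => \bigcup_(i in [set` s]) f i) FB.
  have [i Di fix_] := KD x Kx.
  exists (f i, B [:: i]); first split.
  - exact: open_nbhs_nbhs (conj (Do i Di) fix_).
  - by exists [:: i] => //= j; rewrite inE => /eqP ->.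
  - by move=> [y s] [/= fiy [is_ _]]; exists i => //=; apply: is_; rewrite inE.
by exists s => //; apply: sK; split.
Qed.

Lemma set_type_nbhsP A (x : A) (N : set A) :
  nbhs x N <-> nbhs (val x) [set y | forall z : A, val z = y -> N z].
Proof.
split=> [|].
  case=> _ [[W oW <-] /= Wx WN]; apply: filterS (open_nbhs_nbhs (conj oW Wx)).
  by move=> y Wy z zy; apply: WN; move: Wy; rewrite -zy.
move=> Nx; have := @initial_continuous (A : Type) T set_val x _ Nx.
by rewrite nbhs_simpl; apply: (@filterS _ (nbhs x)) => z; exact.
Qed.

End Topology.

(** * The topology of a groupoid of germs *)

Section GermTopology.
Variables (S : invSemigroupType) (X : topologicalType) (a : space_action S X).
Implicit Types (s t : S) (x y : X).

Local Notation germ := (germ a).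

Lemma act_space_cvg s x : dom a s x ->
  forall N, nbhs (act a s x) N -> nbhs x (act a s @^-1` N).
Proof.
have [od _ cs _] := space_homeo a s.
move: cs; rewrite continuous_open_subspace// => cs sx N Nx.
exact: (cs _ (mem_set sx) N Nx).
Qed.

Lemma dom_nbhs s x : dom a s x -> nbhs x (dom a s).
Proof.
by move=> sx; have [od _ _ _] := space_homeo a s; exact: open_nbhs_nbhs.
Qed.

Lemma to_germ_irr s x y (sx : dom a s x) (sy : dom a s y) : x = y ->
  to_germ (mk_pair sx) = to_germ (mk_pair sy).
Proof.
by move=> xy; apply: (to_germ_eq (u := s)) => //=; exact: sle_refl.
Qed.

(** The map [x |-> [s, x]] is an open embedding of the domain of [s]. Every
    topological fact on germs below is reduced to a fact on [X] by this. *)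
Lemma germ_nbhsP s x (sx : dom a s x) (N : set germ) :
  nbhs (to_germ (mk_pair sx)) N <->
  nbhs x [set y | forall sy : dom a s y, N (to_germ (mk_pair sy))].
Proof.
split=> [|Nx].
  rewrite nbhsE => -[W [oW Wx] WN].
  have : nbhs (mk_pair sx) (@to_germ _ _ a @^-1` W) by exact: open_nbhs_nbhs.
  rewrite /nbhs /= /sigT_nbhs /= /nbhs_simpl /= => /set_type_nbhsP /=.
  apply: filterS => y H sy; apply: WN.
  exact: (H (exist _ y (mem_set sy))).
have : nbhs x (dom a s `&` [set y | forall sy : dom a s y, N (to_germ (mk_pair sy))]).
  by apply: filterI => //; exact: dom_nbhs.
rewrite nbhsE => -[D [oD Dx] DN].
rewrite nbhsE.
exists [set g | exists y (sy : dom a s y), D y /\ g = to_germ (mk_pair sy)].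
  split; last by exists x, sx.
  rewrite /open /= /quotient_open; apply/sigT_openP => t.
  rewrite openE => -[y ty] /= [z [sz [Dz]]] /to_germP [/= yz [u [ut us uy]]].
  rewrite /interior; apply/set_type_nbhsP => /=.
  have {}uy : dom a u y by [].
  have {}yz : y = z by exact: yz.
  subst z.
  have : nbhs y (dom a u `&` D).
    by apply: filterI; [exact: dom_nbhs|exact: open_nbhs_nbhs].
  apply: filterS => z [uz Dz'] [z' tz'] /= zz'; subst z'.
  exists z, (dom_sle us uz); split=> //.
  by apply: (to_germ_eq (u := u)).
by move=> _ [y [sy [Dy ->]]]; have [_] := DN _ Dy; exact.
Qed.

Lemma germ_case (P : germ -> Prop) :
  (forall s x (sx : dom a s x), P (to_germ (mk_pair sx))) -> forall g, P g.
Proof.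
move=> H; elim/germ_ind => -[s [x sx]].
suff -> : sx = mem_set (set_mem sx) by exact: H.
exact: Prop_irrelevance.
Qed.

Lemma germ_src_continuous : continuous (@germ_src S X a).
Proof.
elim/germ_case => s x sx N; rewrite germ_srcE /= => Nx.
apply/germ_nbhsP; apply: filterS Nx => y Ny sy /=.
by rewrite /preimage /= germ_srcE.
Qed.

Lemma germ_rng_continuous : continuous (@germ_rng S X a).
Proof.
elim/germ_case => s x sx N; rewrite germ_rngE /= => Nx.
apply/germ_nbhsP; apply: filterS (act_space_cvg sx Nx) => y Ny sy /=.
by rewrite /preimage /= germ_rngE.
Qed.

Lemma germ_one_continuous : continuous (@germ_one S X a).
Proof.
move=> x N; have [s sx] := space_cover a x; have ssx := domVs sx.
rewrite -(germ_oneE ssx (idemVs s)) => /germ_nbhsP Nx.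
apply: filterS (filterI Nx (dom_nbhs ssx)) => y [Ny ssy].
by rewrite /preimage /= -(germ_oneE ssy (idemVs s)); exact: Ny.
Qed.

(** The inverse was defined on the chosen representative; any representative
    gives it, since a left and a right inverse of an arrow coincide. *)
Lemma germ_invE s x (sx : dom a s x) :
  germ_inv (to_germ (mk_pair sx)) = to_germ (mk_pair (act_dom_inv sx)).
Proof.
set g := to_germ (mk_pair sx).
have gE : germ_mul (germ_inv g) g = germ_one a x by rewrite germ_mulVg germ_srcE.
set h := to_germ (mk_pair (act_dom_inv sx)).
have hE : germ_mul g h = germ_one a (germ_src h).
  rewrite /g /h germ_srcE.
  have e : germ_snd (mk_pair sx) =
    act a (germ_fst (mk_pair (act_dom_inv sx))) (germ_snd (mk_pair (act_dom_inv sx))).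
    by rewrite /= act_invK.
  rewrite (germ_mulE (dom_comp e) e); apply: germ_oneE; exact: idemsV.
have gh : germ_src g = germ_rng h by rewrite germ_srcE germ_rngE /= act_invK.
have ig : germ_src (germ_inv g) = germ_rng g by rewrite germ_src_inv.
rewrite -(germ_mulg1 (germ_inv g)).
have -> : germ_src (germ_inv g) = germ_src h.
  by rewrite germ_src_inv germ_srcE germ_rngE.
rewrite -hE germ_mulA// gE.
have -> : x = germ_rng h by rewrite -gh germ_srcE.
by rewrite germ_mul1g.
Qed.

Lemma germ_inv_continuous : continuous (@germ_inv S X a).
Proof.
elim/germ_case => s x sx N; rewrite germ_invE => /germ_nbhsP Nx.
apply/germ_nbhsP; apply: filterS (act_space_cvg sx Nx) => y Ny sy.
by rewrite /preimage /= germ_invE; exact: Ny.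
Qed.

Lemma germ_mul_continuous :
  {within [set p : germ * germ | germ_src p.1 = germ_rng p.2],
    continuous (fun p : germ * germ => germ_mul p.1 p.2)}.
Proof.
apply/subspace_continuousP => -[g h] /=.
elim/germ_case: g => s x sx; elim/germ_case: h => t y ty.
rewrite germ_srcE germ_rngE => xy N.
rewrite /from_subspace /= (germ_mulE (dom_comp xy) xy) => /germ_nbhsP Ny.
rewrite /= nbhs_simpl /= /within /=.
pose A := [set g : germ | exists z (sz : dom a s z), g = to_germ (mk_pair sz)].
pose B := [set h : germ | exists z (tz : dom a t z), h = to_germ (mk_pair tz) /\
  forall stz : dom a (s * t) z, N (to_germ (mk_pair stz))].
exists (A, B); first split => /=.
- apply/germ_nbhsP; apply: filterS (dom_nbhs sx) => z sz sz'; by exists z, sz'.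
- apply/germ_nbhsP; apply: filterS Ny => z Nz tz; by exists z, tz.
move=> [_ _] /= [[z [sz ->]] [w [tw [-> Nw]]]].
rewrite germ_srcE germ_rngE => zw.
by rewrite /preimage /= (germ_mulE (dom_comp zw) zw); exact: Nw.
Qed.

Lemma germ_src_local_homeo : local_homeo (@germ_src S X a).
Proof.
elim/germ_case => s x sx.
pose D := [set g : germ | exists z (sz : dom a s z), g = to_germ (mk_pair sz)].
have DE : @germ_src S X a @` D = dom a s.
  apply/seteqP; split=> [_ [_ [y [sy ->]] <-]|y sy]; first by rewrite germ_srcE.
  by exists (to_germ (mk_pair sy)); [exists y, sy|rewrite germ_srcE].
have [od _ _ _] := space_homeo a s.
exists D; first by exists x, sx.
split.
- rewrite openE => _ [y [sy ->]]; rewrite /interior; apply/germ_nbhsP.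
  by apply: filterS (dom_nbhs sy) => z _ sz; exists z, sz.
- by rewrite DE.
- apply: continuous_subspaceT; exact: germ_src_continuous.
exists (fun y => if pselect (dom a s y) is left sy then to_germ (mk_pair sy)
                 else to_germ (mk_pair sx)).
  move=> g; rewrite inE => -[y [sy ->]]; rewrite germ_srcE /=.
  by case: pselect => [sy'|//]; exact: to_germ_irr.
rewrite DE continuous_open_subspace// => y; rewrite inE => sy N /=.
case: pselect => // sy' /germ_nbhsP Ny; apply: filterS (filterI Ny (dom_nbhs sy)).
move=> z [Nz sz]; rewrite /preimage /=; case: pselect => // sz'; exact: Nz.
Qed.

Lemma germ_ample : tdlch X -> ample (germ_groupoid a).
Proof.
move=> tX; split=> //; last exact: germ_src_local_homeo.
split.
- exact: germ_src_continuous.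
- exact: germ_rng_continuous.
- exact: germ_one_continuous.
- exact: germ_inv_continuous.
- exact: germ_mul_continuous.
Qed.

End GermTopology.

(** * Equivariant maps and reductions of groupoids of germs *)

Section GermMap.
Variables (S : invSemigroupType) (X Y : topologicalType).
Variables (a : space_action S X) (b : space_action S Y).
Variables (A : set X) (B : set Y) (f : A -> B).
Hypothesis f_cont : continuous f.
Hypothesis f_dom : forall s (x : A), dom a s (val x) -> dom b s (val (f x)).
Hypothesis f_act : forall s (x x' : A), dom a s (val x) ->
  val x' = act a s (val x) -> val (f x') = act b s (val (f x)).

Local Notation redA := (@reduction (germ_groupoid a) A).
Local Notation redB := (@reduction (germ_groupoid b) B).

(** The graph of [[s, x] |-> [s, f x]], in relational form because a germ has
    many representatives. *)
Definition germ_along (g : redA) (h : redB) :=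
  exists s (x : A) (sx : dom a s (val x)) (sy : dom b s (val (f x))),
    val g = to_germ (mk_pair sx) /\ val h = to_germ (mk_pair sy).

Lemma germ_along_fun g h h' : germ_along g h -> germ_along g h' -> h = h'.
Proof.
move=> [s [x [sx [sy [gE hE]]]]] [s' [x' [sx' [sy' [gE' hE']]]]].
apply: val_inj; rewrite hE hE'; move: gE; rewrite gE' => /to_germP[/= xx'].
have {}xx' : x' = x by apply: val_inj.
subst x' => -[u [/= us us' ux]].
by apply: (to_germ_eq (u := u)) => //=; exact: f_dom.
Qed.

Lemma reduction_germP (g : redA) : exists s (x x' : A) (sx : dom a s (val x)),
  val g = to_germ (mk_pair sx) /\ val x' = act a s (val x).
Proof.
case: g => g gP; have [] := set_mem gP; move: gP.
elim/germ_case: g => s x sx gP /= Asrc Arng; exists s.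
rewrite germ_srcE in Asrc; rewrite germ_rngE in Arng.
by exists (exist (fun y => y \in A) x (mem_set Asrc)),
  (exist (fun y => y \in A) _ (mem_set Arng)), sx.
Qed.

Lemma germ_along_ex g : exists h, germ_along g h.
Proof.
have [s [x [x' [sx [gE x'E]]]]] := reduction_germP g.
have sy := f_dom sx; pose h := to_germ (mk_pair sy).
have hB : @reduction (germ_groupoid b) B h.
  split; rewrite /= ?germ_srcE ?germ_rngE /=; first exact: set_mem (valP (f x)).
  by rewrite -(f_act sx x'E); exact: set_mem (valP (f x')).
by exists (exist _ h (mem_set hB)), s, x, sx, sy.
Qed.

Definition germ_map g : redB := projT1 (cid (germ_along_ex g)).

Lemma germ_mapP g : germ_along g (germ_map g).
Proof. by rewrite /germ_map; case: cid. Qed.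

Lemma germ_map_src g : restrict_src (germ_map g) = f (restrict_src g).
Proof.
have [s [x [sx [sy [gE hE]]]]] := germ_mapP g.
have -> : restrict_src g = x by apply: val_inj; rewrite /= gE germ_srcE.
by apply: val_inj; rewrite /= hE germ_srcE.
Qed.

Lemma germ_map_rng g : restrict_rng (germ_map g) = f (restrict_rng g).
Proof.
have [s [x [sx [sy [gE hE]]]]] := germ_mapP g.
apply: val_inj; rewrite /= hE germ_rngE /=; apply/esym/f_act => //=.
by rewrite gE germ_rngE.
Qed.

Lemma germ_map_mul g h : restrict_src g = restrict_rng h ->
  germ_map (restrict_mul g h) = restrict_mul (germ_map g) (germ_map h).
Proof.
move=> gh.
have gh' : restrict_src (germ_map g) = restrict_rng (germ_map h).
  by rewrite germ_map_src germ_map_rng gh.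
apply: germ_along_fun (germ_mapP _) _.
have [s [x [sx [sx' [gE gE']]]]] := germ_mapP g.
have [t [y [ty [ty' [hE hE']]]]] := germ_mapP h.
have xy : germ_snd (mk_pair sx) =
    act a (germ_fst (mk_pair ty)) (germ_snd (mk_pair ty)).
  by have := congr1 val gh; rewrite /= gE hE germ_srcE germ_rngE.
have xy' : germ_snd (mk_pair sx') =
    act b (germ_fst (mk_pair ty')) (germ_snd (mk_pair ty')).
  by have := congr1 val gh'; rewrite /= gE' hE' germ_srcE germ_rngE.
exists (s * t), y, (dom_comp xy), (dom_comp xy').
by rewrite !val_restrict_mul//= gE hE gE' hE' (germ_mulE (dom_comp xy) xy)
  (germ_mulE (dom_comp xy') xy').
Qed.

Lemma germ_map_continuous : continuous germ_map.
Proof.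
move=> g N /set_type_nbhsP; have [s [x [sx [sy [gE hE]]]]] := germ_mapP g.
rewrite hE => /germ_nbhsP Ny; apply/set_type_nbhsP; rewrite gE; apply/germ_nbhsP.
have /f_cont : nbhs (f x) [set y : B | forall sy : dom b s (val y),
    forall z : redB, val z = to_germ (mk_pair sy) -> N z].
  apply/set_type_nbhsP; by apply: filterS Ny => y My z zy; move: My; rewrite -zy.
move=> /set_type_nbhsP; apply: filterS => y Fy sz h hE'.
rewrite /preimage /=; have [s' [x' [sx' [sy' [gE' hE'']]]]] := germ_mapP h.
have x'y : val x' = y.
  by have := congr1 (@germ_src _ _ _) hE'; rewrite gE' !germ_srcE.
subst y; have /= Fx := Fy _ erefl; apply: (Fx (f_dom sz)); rewrite hE''.
move: hE'; rewrite gE' => /to_germP[_ [u [us us' ux]]].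
by apply: (to_germ_eq (u := u)) => //=; exact: f_dom.
Qed.

End GermMap.

(** The identification of germs depends only on the domains of the elements of
    the semigroup, so an equivariant homeomorphism acts on germs by
    [[s, x] |-> [s, f x]]. *)
Lemma grestrict_iso (S : invSemigroupType) (X Y : topologicalType)
    (a : space_action S X) (b : space_action S Y) (A : set X) (B : set Y)
    (f : A -> B) (g : B -> A) :
  continuous f -> continuous g -> cancel f g -> cancel g f ->
  (forall s x, A x -> dom a s x -> A (act a s x)) ->
  (forall s (x : A), dom a s (val x) <-> dom b s (val (f x))) ->
  (forall s (x x' : A), dom a s (val x) -> val x' = act a s (val x) ->
    val (f x') = act b s (val (f x))) ->
  isomorphic (@grestrict (germ_groupoid a) A) (@grestrict (germ_groupoid b) B).
Proof.
move=> fc gc fg gf Ainv fdom fact.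
have f_dom s (x : A) : dom a s (val x) -> dom b s (val (f x)) by move/fdom.
have g_dom s (y : B) : dom b s (val y) -> dom a s (val (g y)).
  by move=> sy; apply/fdom; rewrite gf.
have gact s (y y' : B) : dom b s (val y) -> val y' = act b s (val y) ->
    val (g y') = act a s (val (g y)).
  move=> sy y'E; have sx := g_dom _ _ sy.
  have Ax := Ainv _ _ (set_mem (valP (g y))) sx.
  pose x' : A := exist (fun y => y \in A) _ (mem_set Ax).
  have fx' : f x' = y'.
    by apply: val_inj; rewrite y'E (fact s (g y)) ?gf.
  by rewrite -fx' fg.
exists f, (germ_map f_dom fact); split.
- by split=> //; exists g.
- split; first exact: germ_map_continuous.
  exists (germ_map g_dom gact); split; first exact: germ_map_continuous.
  + move=> h; apply: germ_along_fun g_dom _ _ _ (germ_mapP _ _ _) _.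
    have [s [x [sx [sy [hE h'E]]]]] := germ_mapP f_dom fact h.
    have sx' : dom a s (val (g (f x))) by rewrite fg.
    exists s, (f x), sy, sx'; split=> //.
    by rewrite hE; apply: to_germ_irr; rewrite fg.
  + move=> h; apply: germ_along_fun f_dom _ _ _ (germ_mapP _ _ _) _.
    have [s [y [sy [sx [hE h'E]]]]] := germ_mapP g_dom gact h.
    have sy' : dom b s (val (f (g y))) by rewrite gf.
    exists s, (g y), sx, sy'; split=> //.
    by rewrite hE; apply: to_germ_irr; rewrite gf.
- exact: germ_map_src.
- exact: germ_map_rng.
- exact: germ_map_mul.
Qed.

(** * Partial actions on sets and on semilattices *)

Section PartialActionTheory.
Variables (S : invSemigroupType) (T : Type) (p : partial_action S T).
Implicit Types (s t e : S) (x y : T) (V W : set T).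

Lemma pact_idem e x : idem e -> dom p e x -> act p e x = x.
Proof.
move=> ee ex; have : dom p (e * e) x by rewrite ee.
move=> eex; have := eex; rewrite dom_mul => -[_ /= eax].
apply: (act_inj (p := p) (s := e)); [exact: mem_set|exact: mem_set|].
by rewrite -(act_mul eex) ee.
Qed.

Lemma pact_dom_inv s x : dom p s x -> dom p (sinv s) (act p s x).
Proof.
rewrite -{1}(mulsVs s) -mulgA dom_mul => -[+ _].
by rewrite dom_mul => -[_].
Qed.

Lemma pact_invK s x : dom p s x -> act p (sinv s) (act p s x) = x.
Proof.
move=> sx; have ssx : dom p (sinv s * s) x.
  by rewrite dom_mul; split=> //; exact: pact_dom_inv.
by rewrite -(act_mul ssx) (pact_idem (idemVs s) ssx).
Qed.

Lemma pact_Kinv s y : dom p (sinv s) y -> act p s (act p (sinv s) y) = y.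
Proof. by move=> /pact_invK; rewrite sinvK. Qed.

Lemma pact_inv_dom s y : dom p (sinv s) y -> dom p s (act p (sinv s) y).
Proof. by move=> /pact_dom_inv; rewrite sinvK. Qed.

Lemma ran_sinv s : ran p s = dom p (sinv s).
Proof.
apply/seteqP; split=> [_ [x sx <-]|y sy]; first exact: pact_dom_inv.
by exists (act p (sinv s) y); [exact: pact_inv_dom|exact: pact_Kinv].
Qed.

Lemma pact_image_inv s V : V `<=` dom p s ->
  act p (sinv s) @` (act p s @` V) = V.
Proof.
move=> Vs; apply/seteqP; split=> [_ [_ [x Vx <-] <-]|x Vx].
  by rewrite pact_invK//; exact: Vs.
by exists (act p s x); [exists x|rewrite pact_invK//; exact: Vs].
Qed.

Lemma pact_image_sub s V W : V `<=` dom p s -> W `<=` dom p s ->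
  (act p s @` V `<=` act p s @` W) <-> V `<=` W.
Proof.
move=> Vs Ws; split=> VW; last exact: image_subset.
by rewrite -(pact_image_inv Vs) -(pact_image_inv Ws); exact: image_subset.
Qed.

Lemma pact_imageI s V W : V `<=` dom p s -> W `<=` dom p s ->
  act p s @` (V `&` W) = act p s @` V `&` act p s @` W.
Proof.
move=> Vs Ws; apply/seteqP; split=> [_ [x [Vx Wx] <-]|_ [[x Vx <-]] [y Wy xy]].
  by split; exists x.
suff e : y = x by exists x => //; split=> //; rewrite -e.
by rewrite -(pact_invK (Ws _ Wy)) xy pact_invK//; exact: Vs.
Qed.

Lemma pact_image_mul s t V : V `<=` dom p (s * t) ->
  act p (s * t) @` V = act p s @` (act p t @` V).
Proof.
move=> Vst; apply/seteqP; split=> [_ [x Vx <-]|_ [_ [x Vx <-] <-]].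
  by rewrite act_mul//; [exists (act p t x) => //; exists x|exact: Vst].
by exists x => //; rewrite act_mul//; exact: Vst.
Qed.

End PartialActionTheory.

Section PosetActionTheory.
Variables (S : invSemigroupType) (d : Order.disp_t).

Section Bottom.
Variables (L : bPOrderType d) (aL : poset_action S L).

Lemma poset_act_le s x y : dom aL s x -> dom aL s y ->
  (act aL s x <= act aL s y)%O = (x <= y)%O.
Proof. by move=> sx sy; apply: poset_mono; exact: mem_set. Qed.

Lemma poset_act_bot s : dom aL s \bot%O -> act aL s \bot%O = \bot%O.
Proof.
move=> s0; have : ran aL s \bot%O.
  by apply: poset_ran_down (le0x (act aL s \bot%O)) _; exists \bot%O.
move=> [x sx x0]; apply/eqP; rewrite -lex0 -{2}x0 poset_act_le//; exact: le0x.
Qed.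

Lemma poset_act_eq0 s x : dom aL s x -> act aL s x = \bot%O -> x = \bot%O.
Proof.
move=> sx sx0; have s0 : dom aL s \bot%O by exact: poset_dom_down (le0x x) sx.
apply: (act_inj (p := aL) (s := s)); [exact: mem_set|exact: mem_set|].
by rewrite sx0 poset_act_bot.
Qed.

End Bottom.

Variables (E : bMeetSemilatticeType d) (aE : poset_action S E).
Local Notation meet := Order.meet.

Lemma poset_act_meet s x y : dom aE s x -> dom aE s y ->
  act aE s (meet x y) = meet (act aE s x) (act aE s y).
Proof.
move=> sx sy; have sxy : dom aE s (meet x y).
  by apply: poset_dom_down sx; exact: leIl.
apply/eqP; rewrite eq_le lexI !poset_act_le// leIl leIr /=.
have [z sz zE] : ran aE s (meet (act aE s x) (act aE s y)).
  by apply: poset_ran_down (leIl _ _) _; exists x.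
rewrite -zE poset_act_le// lexI -(poset_act_le sz sx) -(poset_act_le sz sy) zE.
by rewrite leIl leIr.
Qed.

(** Since ranges are down-sets, a meet with a point of the range can be pulled
    back; this is how the values of the induced action are computed. *)
Lemma poset_act_meet_ran s x y : dom aE s x ->
  exists k, [/\ dom aE s k, (k <= x)%O & act aE s k = meet y (act aE s x)].
Proof.
move=> sx; have [k sk kE] : ran aE s (meet y (act aE s x)).
  by apply: poset_ran_down (leIr _ _) _; exists x.
by exists k; split=> //; rewrite -(poset_act_le sk sx) kE leIr.
Qed.

End PosetActionTheory.

(** * Characters of a semilattice *)

Section SemilatticeCharacters.
Variables (d : Order.disp_t) (E : bMeetSemilatticeType d).
Local Notation meet := Order.meet.
Local Notation "0" := (\bot%O : E).
Implicit Types (e f k l : E) (chi : character_space E).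

Lemma wmeetE k l : wmeet k l = [set meet k l].
Proof.
apply/seteqP; split=> [m [[mk ml] mmax]|_ ->].
  by apply/esym/mmax; [split; [exact: leIl|exact: leIr]|rewrite lexI mk].
split; first by split; [exact: leIl|exact: leIr].
by move=> x [xk xl] kx; apply/eqP; rewrite eq_le kx lexI xk xl.
Qed.

Lemma semilattice_weak : weak_semilattice E.
Proof.
move=> k l; exists [set meet k l]; split.
- exact: finite_set1.
- by move=> _ ->; split; [exact: leIl|exact: leIr].
- by move=> m [mk ml]; exists (meet k l) => //; rewrite lexI mk.
Qed.

Lemma semilattice_locally_finite : locally_finite E.
Proof.
move=> A /finite_seqP[s ->{A}].
suff [B [fB sB BI]] : exists B : set E, [/\ finite_set B, [set` s] `<=` B &
    forall x y, B x -> B y -> B (meet x y)].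
  by exists B; split=> // x y Bx By; rewrite wmeetE => _ ->; exact: BI.
elim: s => [|a s [B [fB sB BI]]].
  by exists set0; split=> //; exact: finite_set0.
exists (B `|` [set a] `|` [set meet a b | b in B]); split.
- rewrite !finite_setU; split; last exact: finite_image.
  by split=> //; exact: finite_set1.
- move=> x /=; rewrite inE => /orP[/eqP ->|xs]; left; [by right|left].
  exact: sB.
- have aI b : B b -> [set meet a b | b in B] (meet a b) by exists b.
  move=> x y [[Bx|->]|[b Bb <-]] [[By|->]|[c Bc <-]].
  + by left; left; exact: BI.
  + by rewrite meetC; right; exact: aI.
  + by rewrite meetCA; right; apply: aI; exact: BI.
  + by right; exact: aI.
  + by rewrite meetxx; left; right.
  + by rewrite meetA meetxx; right; exact: aI.
  + by rewrite -meetA; right; apply: aI; exact: BI.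
  + by rewrite meetAC meetxx; right; exact: aI.
  + by rewrite meetACA meetxx; right; apply: aI; exact: BI.
Qed.

Lemma is_characterP (chi : E -> bool) : is_character chi <->
  [/\ exists l, chi l, chi 0 = false &
      forall k l, chi (meet k l) = chi k && chi l].
Proof.
split=> [[ex0 c0 cI]|[ex0 c0 cI]]; split=> // k l.
  apply/idP/andP => [ckl|/(cI k l)[m]]; last by rewrite wmeetE => ->.
  by apply/(cI k l); exists (meet k l); rewrite ?wmeetE.
split=> [[ck cl]|[m]]; first by exists (meet k l); rewrite ?wmeetE// cI ck.
by rewrite wmeetE => ->; rewrite cI => /andP.
Qed.

Lemma char_spaceP chi : [/\ exists l, char_val chi l, char_val chi 0 = false &
  forall k l, char_val chi (meet k l) = char_val chi k && char_val chi l].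
Proof. exact/is_characterP/(set_mem (valP chi)). Qed.

Lemma char_meet chi k l :
  char_val chi (meet k l) = char_val chi k && char_val chi l.
Proof. by have [] := char_spaceP chi. Qed.

Lemma char_bot chi : char_val chi 0 = false.
Proof. by have [] := char_spaceP chi. Qed.

Lemma char_le chi k l : (k <= l)%O -> char_val chi k -> char_val chi l.
Proof. by move=> /meet_idPl <-; rewrite char_meet => /andP[]. Qed.

Lemma char_ext chi psi : char_val chi =1 char_val psi -> chi = psi.
Proof. by move=> e; apply: val_inj; exact/funext. Qed.

Definition mk_char (c : E -> bool) (cP : is_character c) : character_space E :=
  exist (fun c => c \in [set chi : {ptws E -> bool} | is_character chi])
    c (mem_set cP).

Lemma principal_subproof e : e <> 0 -> is_character (fun k => (e <= k)%O).
Proof.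
move=> e0; apply/is_characterP; split=> [||k l]; last exact: lexI.
  by exists e; exact: lexx.
by apply/negP; rewrite lex0 => /eqP.
Qed.

(** The least character containing [e]. If it lies in a union of cylinders, it
    lies in one of them, and that cylinder contains the whole of [cyl e]. *)
Definition principal e (e0 : e <> 0) := mk_char (principal_subproof e0).

Definition cyl e : set (character_space E) := [set chi | char_val chi e].

Lemma cylI e f : cyl (meet e f) = cyl e `&` cyl f.
Proof.
by apply/seteqP; split=> chi; rewrite /cyl /= char_meet; move/andP.
Qed.

Lemma cyl0 : cyl 0 = set0.
Proof. by rewrite -subset0 => chi; rewrite /cyl /= char_bot. Qed.

Lemma cyl_le e f : (e <= f)%O -> cyl e `<=` cyl f.
Proof. by move=> ef chi; exact: char_le. Qed.

Lemma principal_cyl e (e0 : e <> 0) : cyl e (principal e0).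
Proof. exact: lexx. Qed.

Lemma char_neq0 chi e : char_val chi e -> e <> 0.
Proof. by move=> ce e0; move: ce; rewrite e0 char_bot. Qed.

Lemma char_nbhs chi (F : seq E) :
  nbhs chi [set psi | {in F, char_val psi =1 char_val chi}].
Proof.
elim: F => [|e F IH]; first by apply: filterS filterT => psi _ e; rewrite inE.
have He : nbhs chi [set psi | char_val psi e = char_val chi e].
  apply/set_type_nbhsP.
  have /= H : nbhs (val chi : {ptws E -> bool})
      (@^~ e @^-1` [set char_val chi e] : set {ptws E -> bool}).
    apply: (@proj_continuous E (fun=> bool) e (val chi)).
    exact: (@open_nbhs_nbhs _ _ [set char_val chi e]) (conj (discrete_open _) erefl).
  by apply: filterS H => c ce psi pc; move: ce; rewrite -pc.
apply: filterS (filterI He IH) => psi [pe pF] f; rewrite inE => /orP[/eqP ->//|].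
exact: pF.
Qed.

Definition basic e (F : seq E) := cyl e `\` \bigcup_(f in [set` F]) cyl f.

Lemma basicP e F chi :
  basic e F chi <-> char_val chi e /\ {in F, forall f, ~~ char_val chi f}.
Proof.
split=> [[ce cF]|[ce cF]]; split=> //; last by move=> [f /= /cF /negP].
by move=> f fF; apply/negP => cf; apply: cF; exists f.
Qed.

(** The product topology is an initial topology, so it is enough to see that the
    filter of these sets converges at each coordinate. *)
Lemma basic_nbhs chi (N : set (character_space E)) : nbhs chi N ->
  exists e F, basic e F chi /\ basic e F `<=` N.
Proof.
pose D := [set q : E * seq E | basic q.1 q.2 chi].
have FF : Filter (filter_from D (fun q => basic q.1 q.2)).
  apply: filter_from_filter.
    by have [[l cl] _ _] := char_spaceP chi; exists (l, [::]); apply/basicP.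
  move=> [e F] [e' F'] /= /basicP[ce cF] /basicP[ce' cF'].
  exists (meet e e', F ++ F').
    apply/basicP; rewrite char_meet ce ce'; split=> // f.
    by rewrite mem_cat => /orP[/cF|/cF'].
  move=> psi /basicP /=; rewrite char_meet => -[/andP[pe pe'] pF].
  by split; apply/basicP; split=> // f fF; apply: pF; rewrite mem_cat fF ?orbT.
suff cv : filter_from D (fun q => basic q.1 q.2) --> chi.
  by move=> /cv [[e F] Dq sub]; exists e, F.
have val_cv : @set_val _ _ @ filter_from D (fun q => basic q.1 q.2) -->
    (val chi : {ptws E -> bool}).
  apply/cvg_sup => i U [V [[W oW <-] Wi WU]].
  apply: (filterS WU).
  have [c0|c0] := boolP (char_val chi i).
    exists (i, [::]); first by apply/basicP.
    move=> psi /basicP[/= pi _]; rewrite /preimage /= in Wi *.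
    rewrite (_ : set_val psi i = val chi i)//.
    by rewrite -[LHS]/(char_val psi i) pi.
  have [[l cl] _ _] := char_spaceP chi.
  exists (l, [:: i]); first by apply/basicP; split=> // f; rewrite inE => /eqP ->.
  move=> psi /basicP[/= pl pi]; rewrite /preimage /= in Wi *.
  rewrite (_ : set_val psi i = val chi i)//.
  rewrite -[LHS]/(char_val psi i) -[RHS]/(char_val chi i) (negbTE c0).
  exact/negbTE/pi/mem_head.
move=> M /set_type_nbhsP /val_cv; rewrite /= nbhs_simpl => -[q Dq sub].
by exists q => // psi /sub; exact.
Qed.

Lemma nbhs_basic e F chi : basic e F chi -> nbhs chi (basic e F).
Proof.
move=> /basicP[ce cF]; apply: filterS (char_nbhs chi (e :: F)) => psi pE.
apply/basicP; split=> [|f fF]; first by rewrite pE// mem_head.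
by rewrite pE ?cF// inE fF orbT.
Qed.

Lemma basic1 e : basic e [::] = cyl e.
Proof.
by apply/seteqP; split=> [chi /basicP[]//|chi ce]; apply/basicP; split.
Qed.

Lemma cyl_open e : open (cyl e).
Proof.
by rewrite openE => chi ce; rewrite -basic1; apply: nbhs_basic; rewrite basic1.
Qed.

Lemma cyl_closed e : closed (cyl e).
Proof.
rewrite -openC openE => chi /= ce.
apply: filterS (char_nbhs chi [:: e]) => psi /(_ e (mem_head _ _)) /= pE.
by rewrite /cyl /= pE.
Qed.

(** A cluster point in the compact space of all maps to the booleans is a
    character, because being a character is tested on finitely many coordinates
    at a time. Asking for the value [true] at [e] keeps the limit nonzero. *)
Lemma cyl_compact e : compact (cyl e).
Proof.
move=> F PF Fe.
pose v (chi : character_space E) : {ptws E -> bool} := val chi.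
pose G : set_system {ptws E -> bool} := v @ F.
have GP : ProperFilter G by exact: fmap_proper_filter.
have cpt : compact [set: {ptws E -> bool}].
  have := @tychonoff E (fun=> bool) (fun=> setT) (fun=> bool_compact).
  by congr (@compact); apply/seteqP; split.
have [c [_ cG]] := cpt G GP filterT.
(* On finitely many coordinates [c] agrees with an actual character. *)
have agree (s : seq E) : exists psi, cyl e psi /\ {in s, char_val psi =1 c}.
  have Nc : nbhs c [set q : {ptws E -> bool} | {in s, q =1 c}].
    elim: s => [|i s IH]; first by apply: filterS filterT => q _ j; rewrite inE.
    have Hi : nbhs c (@^~ i @^-1` [set c i] : set {ptws E -> bool}).
      apply: (@proj_continuous E (fun=> bool) i c).
      exact: (@open_nbhs_nbhs _ _ [set c i]) (conj (discrete_open _) erefl).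
    apply: filterS (filterI Hi IH) => q [qi qs] j; rewrite inE => /orP[/eqP ->//|].
    exact: qs.
  have Gim : G (v @` cyl e).
    by apply: (@filterS _ F) Fe => psi pe; exists psi.
  by have [_ [[psi pe <-] H]] := cG _ _ Gim Nc; exists psi.
have ce : c e.
  by have [psi [pe /(_ e (mem_head _ _)) <-]] := agree [:: e].
have cP : is_character c.
  apply/is_characterP; split=> [||k l]; first by exists e.
    by have [psi [pe /(_ 0 (mem_head _ _)) <-]] := agree [:: 0]; exact: char_bot.
  have [psi [_ pE]] := agree [:: meet k l; k; l].
  by rewrite -!pE ?inE ?eqxx ?orbT// char_meet.
exists (mk_char cP); split=> // A B FA /set_type_nbhsP NB.
have GA : G (v @` A) by apply: (@filterS _ F) FA => psi pA; exists psi.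
have [_ [[psi Apsi <-] H]] := cG _ _ GA NB; exists psi; split=> //; exact: H.
Qed.

Lemma cyl_cpt_opens e : cpt_opens (cyl e).
Proof. by split; [exact: cyl_open|exact: cyl_compact]. Qed.

Lemma char_zero_dimensional : zero_dimensional (character_space E).
Proof.
move=> chi psi /eqP cp; have [e] : exists e, char_val chi e != char_val psi e.
  apply: contrapT => H; apply: cp; apply: char_ext => e.
  by apply/eqP; apply: contrapT => /negP ne; apply: H; exists e.
case ce : (char_val chi e) => pe.
  exists (cyl e); split=> //; last by rewrite /cyl /=; move: pe; case: char_val.
  by split; [exact: cyl_open|exact: cyl_closed].
exists (~` cyl e); split; rewrite /cyl /= ?ce//.
  split; [exact/closed_openC/cyl_closed|exact/open_closedC/cyl_open].
by apply; move: pe; case: char_val.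
Qed.

Lemma char_hausdorff : hausdorff_space (character_space E).
Proof.
rewrite open_hausdorff => chi psi /char_zero_dimensional[V [[oV cV] Vx Vy]].
exists (V, ~` V); first by rewrite !inE.
by split=> //; [exact: closed_openC|rewrite setICr].
Qed.

Lemma char_tdlch : tdlch (character_space E).
Proof.
split.
- exact: char_hausdorff.
- move=> chi _; rewrite withinET; have [[l cl] _ _] := char_spaceP chi.
  exists (cyl l); first by apply: open_nbhs_nbhs; split=> //; exact: cyl_open.
  by split; [exact: cyl_compact|exact: cyl_closed].
- exact: zero_dimension_totally_disconnected char_zero_dimensional.
Qed.

End SemilatticeCharacters.

(** * The induced action on characters *)

Section InducedAction.
Variables (S : invSemigroupType) (d : Order.disp_t).
Variables (E : bMeetSemilatticeType d) (aE : poset_action S E).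
Local Notation meet := Order.meet.
Implicit Types (s t : S) (e k l : E) (chi psi : character_space E).

Definition char_dom s : set (character_space E) :=
  [set chi | exists2 l, dom aE s l & char_val chi l].

Definition push s chi : E -> bool := fun l =>
  `[< exists k, [/\ ran aE s k, (k <= l)%O & char_val chi (act aE (sinv s) k)] >].

(** Near a character that contains [l0] in the domain of [s], the moved character
    is read off at one element of [E]; continuity is immediate from this. *)
Lemma pushE s chi l0 l : dom aE s l0 -> char_val chi l0 ->
  push s chi l = char_val chi (act aE (sinv s) (meet l (act aE s l0))).
Proof.
move=> sl0 cl0; have [k [sk kl0 kE]] := poset_act_meet_ran l sl0.
rewrite -kE pact_invK//; apply/asboolP/idP => [[m []]|ck].
  move=> [n sn <-] nl; rewrite pact_invK// => cn.
  apply: (@char_le _ _ _ (meet n l0)); last by rewrite char_meet cn.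
  have snl0 : dom aE s (meet n l0) by exact: poset_dom_down (leIl _ _) sn.
  rewrite -(poset_act_le snl0 sk) kE poset_act_meet// leI2//.
exists (act aE s k); split; first by exists k.
  by rewrite kE; exact: leIl.
by rewrite pact_invK.
Qed.

Lemma push_act s chi k : char_dom s chi -> dom aE s k ->
  push s chi (act aE s k) = char_val chi k.
Proof.
move=> [l0 sl0 cl0] sk; rewrite (pushE _ sl0 cl0) -poset_act_meet//.
rewrite pact_invK ?char_meet ?cl0 ?andbT//.
exact: poset_dom_down (leIl _ _) sk.
Qed.

Lemma push_char s chi : char_dom s chi -> is_character (push s chi).
Proof.
move=> sc; have [l0 sl0 cl0] := sc; apply/is_characterP; split.
- by exists (act aE s l0); rewrite push_act.
- rewrite (pushE _ sl0 cl0); have [k [sk kl0 kE]] := poset_act_meet_ran \bot%O sl0.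
  rewrite -kE pact_invK//; move: kE; rewrite meet0x => /(poset_act_eq0 sk) ->.
  exact: char_bot.
- move=> k l; rewrite !(pushE _ sl0 cl0).
  have [k' [sk kl0 kE]] := poset_act_meet_ran k sl0.
  have [l' [sl ll0 lE]] := poset_act_meet_ran l sl0.
  have skl : dom aE s (meet k' l') by exact: poset_dom_down (leIl _ _) sk.
  have -> : meet (meet k l) (act aE s l0) = act aE s (meet k' l').
    by rewrite poset_act_meet// kE lE meetACA meetxx.
  by rewrite -kE -lE !pact_invK// char_meet.
Qed.

Definition char_act s chi : character_space E :=
  if pselect (is_character (push s chi)) is left cP then mk_char cP else chi.

Lemma char_actE s chi l : char_dom s chi ->
  char_val (char_act s chi) l = push s chi l.
Proof. by move=> /push_char cP; rewrite /char_act; case: pselect. Qed.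

Lemma char_act_act s chi k : char_dom s chi -> dom aE s k ->
  char_val (char_act s chi) (act aE s k) = char_val chi k.
Proof. by move=> sc sk; rewrite char_actE// push_act. Qed.

(** A character nonzero somewhere on the range of [s] is determined by its
    restriction to that range, because taking meets with an element that it
    contains does not change its values. All identities between moved characters
    are proved through this uniqueness. *)
Lemma char_act_uniq s chi psi l0 : dom aE s l0 -> char_val chi l0 ->
  (forall k, dom aE s k -> char_val psi (act aE s k) = char_val chi k) ->
  char_act s chi = psi.
Proof.
move=> sl0 cl0 psiE; have sc : char_dom s chi by exists l0.
apply: char_ext => l; rewrite char_actE// (pushE _ sl0 cl0).
have [k [sk kl0 kE]] := poset_act_meet_ran l sl0.
by rewrite -kE pact_invK// -psiE// kE char_meet psiE// cl0 andbT.
Qed.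

Lemma char_act_invK s chi : char_dom s chi ->
  char_act (sinv s) (char_act s chi) = chi.
Proof.
move=> sc; have [l sl cl] := sc.
apply: (@char_act_uniq _ _ _ (act aE s l)).
- exact: pact_dom_inv.
- by rewrite char_act_act.
- move=> k sk; rewrite -{2}(pact_Kinv sk) char_act_act//.
  exact: pact_inv_dom.
Qed.

Lemma char_act_inj s : {in char_dom s &, injective (char_act s)}.
Proof.
move=> chi psi; rewrite !inE => sc sp cp.
by rewrite -(char_act_invK sc) cp char_act_invK.
Qed.

Lemma char_dom_mul s t :
  char_dom (s * t) = char_dom t `&` char_act t @^-1` char_dom s.
Proof.
apply/seteqP; split=> chi.
  move=> [l]; rewrite dom_mul => -[tl /= stl] cl.
  have tc : char_dom t chi by exists l.
  by split=> //; exists (act aE t l); rewrite ?char_act_act.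
move=> [tc [m sm]]; have [l tl cl] := tc.
have [k [tk kl kE]] := poset_act_meet_ran m tl => cm.
exists k.
  rewrite dom_mul; split=> //=; apply: poset_dom_down sm.
  by rewrite kE; exact: leIl.
by rewrite -(char_act_act tc tk) kE char_meet cm char_act_act.
Qed.

Lemma char_act_mul s t chi : char_dom (s * t) chi ->
  char_act (s * t) chi = char_act s (char_act t chi).
Proof.
move=> stc; have := stc; rewrite char_dom_mul => -[tc sc].
have [l stl cl] := stc; apply: (char_act_uniq stl cl) => k stk.
rewrite act_mul//; move: stk; rewrite dom_mul => -[tk sk].
by rewrite !char_act_act.
Qed.

Definition char_partial_action : partial_action S (character_space E) :=
  PartialAction char_act_inj char_dom_mul char_act_mul.

Lemma char_dom_open s : open (char_dom s).
Proof.
have -> : char_dom s = \bigcup_(l in dom aE s) cyl l by [].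
by apply: bigcup_open => l _; exact: cyl_open.
Qed.

Lemma char_act_image s : char_act s @` char_dom s = char_dom (sinv s).
Proof. exact: (ran_sinv char_partial_action s). Qed.

Lemma char_act_continuous s : {within char_dom s, continuous (char_act s)}.
Proof.
rewrite continuous_open_subspace; last exact: char_dom_open.
move=> chi; rewrite inE => sc; have [l0 sl0 cl0] := sc.
pose back l := act aE (sinv s) (meet l (act aE s l0)).
move=> N /basic_nbhs[e [F [/basicP[ce cF] sub]]].
apply: filterS (char_nbhs chi (l0 :: back e :: map back F)) => psi psiE.
have pl0 : char_val psi l0 by rewrite psiE// mem_head.
have sp : char_dom s psi by exists l0.
have eqb l : back l \in l0 :: back e :: map back F ->
    char_val (char_act s psi) l = char_val (char_act s chi) l.
  by move=> /psiE pE; rewrite !char_actE// !(pushE _ sl0)// -/(back l) pE.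
apply: sub; apply/basicP; split=> [|f fF].
  by rewrite eqb// !inE eqxx orbT.
by rewrite eqb ?cF// !inE (map_f back fF) !orbT.
Qed.

Lemma char_partial_homeo s : partial_homeo (char_dom s) (char_act s).
Proof.
split; rewrite ?char_act_image; do ?exact: char_dom_open.
  exact: char_act_continuous.
exists (char_act (sinv s)); last exact: char_act_continuous.
by move=> chi; rewrite inE; exact: char_act_invK.
Qed.

Lemma char_dom0 : char_dom (szero : S) = set0.
Proof.
rewrite -subset0 => chi [l /poset_dom0 ->]; by rewrite char_bot.
Qed.

Lemma char_cover chi : exists s, char_dom s chi.
Proof.
have [[l cl] _ _] := char_spaceP chi.
by have [s sl] := poset_cover aE (char_neq0 cl); exists s, l.
Qed.

Definition char_action : space_action S (character_space E) :=
  @SpaceAction _ _ char_partial_action char_partial_homeo char_dom0 char_cover.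

Lemma char_action_induced : induced_action aE char_action.
Proof.
move=> s; split=> // chi sc l; rewrite [char_val _ _](char_actE _ sc).
by split=> [/asboolP|?]; [|exact/asboolP].
Qed.

Lemma char_dom_cyl s e : e <> \bot%O -> cyl e `<=` char_dom s <-> dom aE s e.
Proof.
move=> e0; split=> [/(_ _ (principal_cyl e0))[l sl]|se chi ce]; last by exists e.
by move=> el; exact: poset_dom_down el sl.
Qed.

Lemma char_act_cyl s e : dom aE s e ->
  char_act s @` cyl e = cyl (act aE s e).
Proof.
move=> se; apply/seteqP; split=> [_ [chi ce <-]|psi pe].
  by rewrite /cyl /= char_act_act//; exists e.
have pd : char_dom (sinv s) psi.
  by exists (act aE s e) => //; exact: pact_dom_inv.
exists (char_act (sinv s) psi); last first.
  by have := char_act_invK pd; rewrite sinvK.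
by rewrite /cyl /= -(pact_invK se) char_act_act//; exact: pact_dom_inv.
Qed.

Definition cyls : set (set (character_space E)) :=
  [set cyl e | e in [set e : E | e <> \bot%O]].

End InducedAction.

(** * The regular basis of cylinders *)

Lemma bigcup_seq_closed (T : Type) (I : choiceType) (M : set (set T)) (s : seq I)
    (f : I -> set T) : fin_union_closed M -> {in s, forall i, M (f i)} ->
  M (\bigcup_(i in [set` s]) f i).
Proof.
move=> [M0 MU]; rewrite bigcup_seq; elim: s => [|i s IH] Ms; first by rewrite big_nil.
rewrite big_cons; apply: MU; first by apply: Ms; rewrite mem_head.
by apply: IH => j js; apply: Ms; rewrite inE js orbT.
Qed.

Section RegularBasis.
Variables (S : invSemigroupType) (d : Order.disp_t).
Variables (E : bMeetSemilatticeType d) (aE : poset_action S E).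
Local Notation meet := Order.meet.
Implicit Types (e f : E).

(** Relative complements require the removed set to be a subset. *)
Lemma basic_shrink e (F : seq E) :
  basic e F = cyl e `\` \bigcup_(f in [set` F]) cyl (meet e f).
Proof.
apply/seteqP; split=> chi [ce cF]; split=> // -[f fF cf]; apply: cF; exists f => //.
  by move: cf; rewrite cylI => -[].
by rewrite cylI; split.
Qed.

Lemma cyls_regular : regular_basis (@cyls _ E).
Proof.
have cylsP e : (@cyls _ E `|` [set set0]) (cyl e).
  by have [->|/eqP e0] := eqVneq e \bot%O; [right; exact: cyl0|left; exists e].
split.
- by move=> _ [e e0 <-]; split; [exact: cyl_cpt_opens|
    exists (principal e0); exact: principal_cyl].
- move=> V W [[e e0 <-]|->]; last by rewrite set0I; right.
  move=> [[f f0 <-]|->]; last by rewrite setI0; right.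
  by rewrite -cylI.
- apply/seteqP; split=> [V|V [oV cV] M [[MU MI MD] cylM]].
    move=> /(_ (@cpt_opens _)) VM; apply: VM; split; last first.
      by move=> _ [e _ <-]; exact: cyl_cpt_opens.
    have cl := compact_closed (@char_hausdorff _ E).
    split.
    + split; first by split; [exact: open0|exact: compact0].
      by move=> A B [oA cA] [oB cB]; split; [exact: openU|exact: compactU].
    + move=> A B [oA cA] [oB cB]; split; [exact: openI|].
      by apply: compact_closedI => //; exact: cl.
    + move=> A B [oA cA] [oB cB] _; rewrite setDE; split.
        by apply: openI => //; apply: closed_openC; exact: cl.
      by apply: compact_closedI => //; exact: open_closedC.
have Mcyl e : M (cyl e).
  by have [/cylM//|->] := cylsP e; case: MU.
have Mbasic e F : M (basic e F).
  rewrite basic_shrink; apply: MD => //.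
    by apply: bigcup_seq_closed => // f _.
  by move=> chi [f _]; rewrite cylI => -[].
pose D := [set q : E * seq E | basic q.1 q.2 `<=` V].
have [|chi Vchi|s Ds Vs] := @compact_cover_seq _ (E * seq E)%type V D
    (fun q => basic q.1 q.2) cV.
- by move=> q _; rewrite openE => chi; exact: nbhs_basic.
- have [e [F [ceF sub]]] := basic_nbhs (open_nbhs_nbhs (conj oV Vchi)).
  by exists (e, F).
suff -> : V = \bigcup_(q in [set` s]) basic q.1 q.2.
  by apply: bigcup_seq_closed => // q _.
by apply/seteqP; split=> // chi [q /= /Ds]; exact.
- move=> V n W [e e0 <-] BW /(_ _ (principal_cyl e0))[i _ Wi]; exists i.
  have [f _ fW] := BW i; rewrite -fW in Wi *.
  exact: cyl_le.
Qed.

Lemma cyls_invariant : invariant_basis (char_action aE) (@cyls _ E).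
Proof.
move=> s; split.
  apply/seteqP; split=> [chi [e se ce]|chi [V [_ Vs] Vc]]; last exact: Vs.
  exists (cyl e) => //; split; first by exists e => //; exact: (char_neq0 ce).
  by move=> psi pe; exists e.
move=> _ [e e0 <-] /(char_dom_cyl _ _ e0) se; exists (act aE s e).
  by move=> /(poset_act_eq0 se).
by rewrite -(char_act_cyl se).
Qed.

End RegularBasis.

(** * Coverings and the characters that respect them *)

Section Refines.
Variables (d : Order.disp_t) (E : bMeetSemilatticeType d).

(** The tree of covers of a thorough system. As an inductive predicate it makes the
    depth and the choice of covers at each node implicit, and its recursion
    principle is the argument that follows a character down the tree. *)
Inductive refines (R : E -> set (set E)) (T : set E) : E -> Prop :=
| refines_leaf e of T e : refines R T e
| refines_cover e F of R e F & (forall f, F f -> refines R T f) : refines R T e.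

(** With [\bot] included the leaves of a tree may be empty sets. *)
Definition below (s : seq E) : set E :=
  [set x | x = \bot%O \/ exists2 i, i \in s & (x <= i)%O].

(** Only the down-set generated by a cover matters for the characters. Working up
    to this relation spares the later systems of covers the passage to maximal
    elements. *)
Definition same_down (F F' : set E) :=
  (forall f, F f -> exists2 f', F' f' & (f <= f')%O) /\
  (forall f', F' f' -> exists2 f, F f & (f' <= f)%O).

End Refines.

(** The hypotheses in the form that passes from one stage to the next. The sets
    [U e] need not exhaust [X]: after the first stage they fill only the open set
    that is still to be resolved. The field [cov_down] leaves out the restriction to
    [\bot], so that the empty gap, which has no root, can be left without covers. *)
Record covering (S : invSemigroupType) (X : topologicalType)
    (a : space_action S X) (d : Order.disp_t) (E : bMeetSemilatticeType d)
    (aE : poset_action S E) (U : E -> set X) (R : E -> set (set E)) : Prop :=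
  Covering {
  cov_hausdorff : hausdorff_space X;
  cov_rep : representation U;
  cov_basis : forall e x N, U e x -> nbhs x N -> exists e' (F : seq E),
    [/\ U e' x, {in F, forall f, ~ U f x} &
        U e' `\` \bigcup_(f in [set` F]) U f `<=` N];
  cov_dom : forall s, \bigcup_e U e `&` dom a s = \bigcup_(e in dom aE s) U e;
  cov_act : forall s e, dom aE s e -> act a s @` U e = U (act aE s e);
  cov_finite : forall e F, R e F -> finite_set F;
  cov_le : forall e F f, R e F -> F f -> (f <= e)%O;
  cov_down : forall e F k, R e F -> (k <= e)%O -> k <> \bot%O ->
    exists2 F', R k F' & same_down F' [set Order.meet k f | f in F];
  cov_concrete : forall e F, R e F -> concrete U e F;
  cov_invariant : invariant_system aE R;
  cov_thorough : forall e (s : seq E),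
    U e `<=` \bigcup_(i in [set` s]) U i -> refines R (below s) e
}.

Section CoveredCharacters.
Variables (S : invSemigroupType) (X : topologicalType).
Variables (a : space_action S X) (d : Order.disp_t).
Variables (E : bMeetSemilatticeType d) (aE : poset_action S E).
Variables (U : E -> set X) (R : E -> set (set E)).
Hypothesis cov : covering a aE U R.
Local Notation meet := Order.meet.
Local Notation aC := (char_action aE).
Implicit Types (e f : E) (x y : X) (chi psi : character_space E).

Definition extent := \bigcup_e U e.

Definition uncovered (F : set E) : set (character_space E) :=
  ~` \bigcup_(f in F) cyl f.

Definition gap e F := cyl e `&` uncovered F.

(** Defined by its complement, which is visibly open. *)
Definition covered : set (character_space E) :=
  ~` \bigcup_(q in [set q : E * set E | R q.1 q.2]) gap q.1 q.2.

Lemma coveredP chi : covered chi <->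
  forall e F, R e F -> char_val chi e -> exists2 f, F f & char_val chi f.
Proof.
split=> [cc e F RF ce|cc [[e F] /= RF [ce]]]; last first.
  by apply; have [f Ff cf] := cc e F RF ce; exists f.
apply: contrapT => nf; apply: cc; by exists (e, F).
Qed.

Lemma uncovered_open F : finite_set F -> open (uncovered F).
Proof.
move=> fF; apply: closed_openC; apply: closed_bigcup => // f _.
exact: cyl_closed.
Qed.

Lemma uncovered_closed F : closed (uncovered F).
Proof.
by apply: open_closedC; apply: bigcup_open => f _; exact: cyl_open.
Qed.

Lemma covered_closed : closed covered.
Proof.
apply: open_closedC; apply: bigcup_open => -[e F] /= RF.
by apply: openI; [exact: cyl_open|exact: uncovered_open (cov_finite cov RF)].
Qed.

(** A cover of an element of the range is first restricted below the range, so
    that it can be transported back along [s]. *)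
Lemma covered_act s chi : dom aC s chi -> covered chi -> covered (act aC s chi).
Proof.
move=> sc /coveredP cc; have [l0 sl0 cl0] := sc.
apply/coveredP => e F RF sce.
have [k [sk kl0 kE]] := poset_act_meet_ran e sl0.
have ck : char_val chi k.
  by rewrite -(char_act_act sc sk) kE char_meet sce char_act_act.
have ke : (act aE s k <= e)%O by rewrite kE leIl.
have k0 : act aE s k <> \bot%O by move/(poset_act_eq0 sk); exact: char_neq0 ck.
have [F' RF' [F'F _]] := cov_down cov RF ke k0.
have := cov_invariant cov (pact_dom_inv sk) RF'; rewrite pact_invK// => Rk.
have [_ [f' F'f' <-] cf'] := cc _ _ Rk ck.
have [_ [f Ff <-] f'f] := F'F _ F'f'; exists f => //.
have sf' : dom aE (sinv s) f'.
  rewrite -ran_sinv; apply: poset_ran_down (cov_le cov RF' F'f') _.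
  by exists k.
apply: (char_le (le_trans f'f (leIr _ _))).
by rewrite -(pact_Kinv sf') [char_val _ _]char_act_act//; exact: pact_inv_dom.
Qed.

Lemma covered_ginvariant : @ginvariant (germ_groupoid aC) covered.
Proof.
elim/germ_case => s chi sc /=; rewrite germ_srcE germ_rngE /=.
split; first exact: covered_act.
by move=> /(covered_act (act_dom_inv sc)); rewrite act_invK.
Qed.

Lemma refines_covered chi T e : covered chi -> refines R T e ->
  char_val chi e -> exists2 t, T t & char_val chi t.
Proof.
move=> /coveredP cc; elim=> {}e; first by exists e.
move=> F RF _ IH /(cc _ _ RF)[f Ff]; exact: IH Ff.
Qed.

Lemma U_closed e : closed (U e).
Proof.
have [cU _ _] := cov_rep cov; have [_] := cU e.
exact: compact_closed (cov_hausdorff cov).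
Qed.

Definition ev x : E -> bool := fun e => `[< U e x >].

Lemma evP x e : ev x e <-> U e x.
Proof. by split=> [/asboolP|?]; [|exact/asboolP]. Qed.

Lemma ev_char x : extent x -> is_character (ev x).
Proof.
have [_ U0 UI] := cov_rep cov.
move=> [e _ Ue]; apply/is_characterP; split; first by exists e; apply/evP.
  by apply/negP => /evP; rewrite U0.
move=> k l; apply/idP/andP => [/evP|[/evP Uk /evP Ul]].
  by rewrite UI => -[Uk Ul]; split; apply/evP.
by apply/evP; rewrite UI.
Qed.

Lemma ev_covered x (xO : extent x) : covered (mk_char (ev_char xO)).
Proof.
apply/coveredP => e F RF /evP; rewrite (cov_concrete cov RF) => -[f Ff Uf].
by exists f => //; apply/evP.
Qed.

(** The sets [U e] separate points, being a basis up to relative complements. *)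
Lemma ev_inj x y : extent x -> ev x =1 ev y -> x = y.
Proof.
move=> [e _ Ue] xy; apply: contrapT => nxy.
have Nx : nbhs x (~` [set y]).
  apply: open_nbhs_nbhs; split=> //; apply: closed_openC.
  exact/accessible_closed_set1/hausdorff_accessible/(cov_hausdorff cov).
have [e' [F [Ux Fx sub]]] := cov_basis cov Ue Nx.
apply: (sub y) => //; split; first by apply/evP; rewrite -xy; apply/evP.
by move=> [f fF /evP]; rewrite -xy => /evP; exact: Fx.
Qed.

(** The sets [U e] with [e] in the character, minus the [U f] with [f] outside it,
    have a common point by compactness: an empty finite intersection would give
    an inclusion that thoroughness contradicts. *)
Lemma covered_point chi : covered chi ->
  exists2 x, extent x & ev x =1 char_val chi.
Proof.
move=> cc; have [[e0 ce0] _ _] := char_spaceP chi.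
have [cU U0 UI] := cov_rep cov.
pose A e (F : seq E) := U (meet e0 e) `\` \bigcup_(f in [set` F]) U f.
pose D := [set V | exists e F, [/\ char_val chi e,
  {in F, forall f, ~~ char_val chi f} & V = A e F]].
suff [x Dx] : \bigcap_(V in D) V !=set0.
  have xP e : char_val chi e -> U e x.
    move=> ce; have [] : A e [::] x by apply: Dx; exists e, [::]; split.
    by rewrite UI => -[].
  exists x; first by exists e0 => //; exact: xP.
  move=> e; apply/idP/idP => [/evP Ue|ce]; last exact/evP/xP.
  apply: contrapT => /negP ce.
  have [_] : A e0 [:: e] x.
    by apply: Dx; exists e0, [:: e]; split=> // f; rewrite inE => /eqP ->.
  by apply; exists e => //=; rewrite inE.
apply: contrapT => D0.
have [] := @compact_filtered_capI _ D (U e0) set0 (proj2 (cU e0)).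
- exact: open0.
- by exists (A e0 [::]), e0, [::]; split.
- move=> _ [e [F [_ _ ->]]]; split; last by move=> x; rewrite /A UI => -[[]].
  apply: closedI; first exact: U_closed.
  by apply/open_closedC/bigcup_open => f _; have [] := cU f.
- move=> _ _ [e [F [ce cF ->]]] [e' [F' [ce' cF' ->]]].
  exists (meet e e'), (F ++ F'); split.
  + by rewrite char_meet ce ce'.
  + by move=> f; rewrite mem_cat => /orP[/cF|/cF'].
  apply/seteqP; split=> x.
    rewrite /A !UI => -[[[U0x Ue] nF] [[_ Ue'] nF']]; split=> // -[f /=].
    by rewrite mem_cat => /orP[fF|fF'] Uf; [apply: nF|apply: nF']; exists f.
  rewrite /A !UI => -[[U0x [Ue Ue']] nF]; split; split=> // -[f /= fF Uf];
    apply: nF; exists f => //=; by rewrite mem_cat fF ?orbT.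
- by move=> x Dx; apply: D0; exists x.
move=> _ [e [F [ce cF ->]]]; rewrite subset0 setD_eq0.
move=> /(cov_thorough cov) /(refines_covered cc).
rewrite char_meet ce0 ce => /(_ isT)[t [->|[i iF ti]]]; first by rewrite char_bot.
by move=> /(char_le ti); apply/negP; exact: cF.
Qed.

Definition to_covered (x : extent) : covered :=
  exist (fun c => c \in covered) _ (mem_set (@ev_covered _ (set_mem (valP x)))).

Lemma of_covered_ex (c : covered) : exists x : extent, to_covered x = c.
Proof.
have [x xO xE] := covered_point (set_mem (valP c)).
exists (exist (fun x => x \in extent) x (mem_set xO)).
by apply: val_inj; apply: char_ext => e; rewrite -xE.
Qed.

Definition of_covered (c : covered) : extent := projT1 (cid (of_covered_ex c)).

Lemma of_coveredK : cancel of_covered to_covered.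
Proof. by move=> c; rewrite /of_covered; case: cid. Qed.

Lemma to_covered_inj : injective to_covered.
Proof.
move=> x y xy; apply: val_inj; apply: ev_inj; first exact: set_mem (valP x).
by move=> e; move: xy => /(congr1 (fun c : covered => char_val (val c) e)).
Qed.

Lemma to_coveredK : cancel to_covered of_covered.
Proof. by move=> x; apply: to_covered_inj; rewrite of_coveredK. Qed.

Lemma to_coveredE (x : extent) e : char_val (val (to_covered x)) e <-> U e (val x).
Proof. exact: evP. Qed.

Lemma of_coveredE (c : covered) e : char_val (val c) e <-> U e (val (of_covered c)).
Proof. by rewrite -{1}(of_coveredK c) to_coveredE. Qed.

Lemma to_covered_continuous : continuous to_covered.
Proof.
have [cU _ _] := cov_rep cov.
move=> x N /set_type_nbhsP/basic_nbhs[e [F [/basicP[xe xF] sub]]].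
apply/set_type_nbhsP.
have Ux : nbhs (val x) (U e `\` \bigcup_(f in [set` F]) U f).
  apply: open_nbhs_nbhs; split.
    apply: openI; first by have [] := cU e.
    apply/closed_openC/closed_bigcup => [|f _]; first exact: finite_seq.
    exact: U_closed.
  split; first exact/to_coveredE.
  by move=> [f fF] /to_coveredE; apply/negP; exact: xF.
apply: filterS Ux => y [Ue nF] z zy; apply: (sub (val (to_covered z))) => //.
apply/basicP; split; first by apply/to_coveredE; rewrite zy.
by move=> f fF; apply/negP => /to_coveredE; rewrite zy => Uf; apply: nF; exists f.
Qed.

Lemma of_covered_continuous : continuous of_covered.
Proof.
move=> c N /set_type_nbhsP Nx; apply/set_type_nbhsP.
have [e _ Ue] := set_mem (valP (of_covered c)).
have [e' [F [Ux Fx sub]]] := cov_basis cov Ue Nx.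
have : nbhs (val c) (basic e' F).
  apply/nbhs_basic/basicP; split; first exact/of_coveredE.
  by move=> f fF; apply/negP => /of_coveredE; exact: Fx.
apply: filterS => psi /basicP[pe pF] c' c'E.
apply: (sub (val (of_covered c'))) => //; split.
  by apply/of_coveredE; rewrite c'E.
by move=> [f /= fF /of_coveredE]; rewrite c'E; apply/negP; exact: pF.
Qed.

Lemma extent_dom s x : extent x -> dom a s x <->
  exists2 e, dom aE s e & U e x.
Proof.
move=> xO; split=> [sx|[e se Ue]].
  by have : (\bigcup_e U e `&` dom a s) x by []; rewrite (cov_dom cov).
have : (\bigcup_(e in dom aE s) U e) x by exists e.
by rewrite -(cov_dom cov) => -[].
Qed.

Lemma extent_act s e x : dom aE s e -> dom a s x -> U e x ->
  U (act aE s e) (act a s x).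
Proof. by move=> se sx Ue; rewrite -(cov_act cov se); exists x. Qed.

(** The closed half of each stage of the resolution. Equivariance holds since
    the induced action on characters mimics the images [s.(U e) = U (s.e)]. *)
Lemma covered_iso : isomorphic (@grestrict (germ_groupoid a) extent)
  (@grestrict (germ_groupoid aC) covered).
Proof.
apply: (grestrict_iso to_covered_continuous of_covered_continuous
  to_coveredK of_coveredK).
- move=> s x xO sx; have [e se Ue] := (extent_dom s xO).1 sx.
  by exists (act aE s e) => //; exact: extent_act.
- move=> s x; have xO := set_mem (valP x); split.
    by move=> /(extent_dom s xO)[e se Ue]; exists e => //; exact/to_coveredE.
  move=> [e se xe]; apply/(extent_dom s xO); exists e => //; exact/to_coveredE.
- move=> s x x' sx x'E; have xO := set_mem (valP x).
  have [e se Ue] := (extent_dom s xO).1 sx.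
  apply/esym/(char_act_uniq se); first exact/to_coveredE.
  move=> k sk; apply/idP/idP => [/to_coveredE|/to_coveredE Uk].
    rewrite x'E -(cov_act cov sk) => -[y Uy yx]; apply/to_coveredE.
    have sy : dom a s y by apply/(extent_dom s); [exists k|exists k].
    rewrite -(act_inj (p := a) (s := s) _ _ yx)//; exact: mem_set.
  by apply/to_coveredE; rewrite x'E; exact: extent_act.
Qed.

End CoveredCharacters.

(** * Semilattices of subsets *)

Fact family_display : Order.disp_t.
Proof. exact: Order.Disp tt tt. Qed.

(** The closure properties are kept as arguments so that the semilattice
    structure below can be found from the type. *)
Definition set_family (T : Type) (B : set (set T)) of B set0 & setI_closed B : Type :=
  set_type B.

Section Family.
Variables (T : Type) (B : set (set T)) (B0 : B set0) (BI : setI_closed B).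
Local Notation fam := (set_family B0 BI).

HB.instance Definition _ := Choice.copy fam (set_type B).
HB.instance Definition _ := SubType.copy fam (set_type B).

Definition famset (V : fam) : set T := val (V : set_type B).

Lemma famsetP V : B (famset V).
Proof. exact: set_mem (valP (V : set_type B)). Qed.

Lemma famset_inj : injective famset.
Proof. by move=> V W; exact: val_inj. Qed.

Definition mk_fam V (BV : B V) : fam := exist (fun V => V \in B) V (mem_set BV).

Definition fam_le (V W : fam) := `[< famset V `<=` famset W >].

Lemma fam_le_refl : reflexive fam_le.
Proof. by move=> V; apply/asboolP. Qed.

Lemma fam_le_anti : antisymmetric fam_le.
Proof.
move=> V W /andP[/asboolP VW /asboolP WV]; apply: famset_inj.
by apply/seteqP; split.
Qed.

Lemma fam_le_trans : transitive fam_le.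
Proof.
by move=> V W Z /asboolP WV /asboolP VZ; apply/asboolP; exact: subset_trans VZ.
Qed.

HB.instance Definition _ :=
  Order.Le_isPOrder.Build family_display fam fam_le_refl fam_le_anti fam_le_trans.

Lemma fam_bot_le V : (mk_fam B0 <= V)%O.
Proof. by apply/asboolP. Qed.

HB.instance Definition _ :=
  Order.hasBottom.Build family_display fam fam_bot_le.

Definition fam_meet (V W : fam) : fam := mk_fam (BI (famsetP V) (famsetP W)).

Lemma fam_lexI V W Z : (V <= fam_meet W Z)%O = (V <= W)%O && (V <= Z)%O.
Proof.
apply/asboolP/andP => [VWZ|[/asboolP VW /asboolP VZ]].
  by split; apply/asboolP => x /VWZ[].
by move=> x Vx; split; [exact: VW|exact: VZ].
Qed.

HB.instance Definition _ :=
  Order.POrder_isMeetSemilattice.Build family_display fam fam_lexI.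

Lemma famset_le (V W : fam) : (V <= W)%O <-> famset V `<=` famset W.
Proof. by split=> [/asboolP|?]; [|exact/asboolP]. Qed.

Lemma famset_meet (V W : fam) : famset (Order.meet V W) = famset V `&` famset W.
Proof. by []. Qed.

Lemma fam_eq_bot (V : fam) : V = \bot%O <-> famset V = set0.
Proof. by split=> [->//|V0]; apply: famset_inj. Qed.

(** Total, so that covers can be written down before their members are known to
    belong to the family. *)
Definition in_fam (A : set T) : fam :=
  if pselect (B A) is left BA then mk_fam BA else \bot%O.

Lemma in_famE A : B A -> famset (in_fam A) = A.
Proof. by move=> BA; rewrite /in_fam; case: pselect. Qed.

End Family.

Section FamilyAction.
Variables (S : invSemigroupType) (X : topologicalType) (a : space_action S X).
Variables (B : set (set X)) (B0 : B set0) (BI : setI_closed B).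
Hypothesis Bact : forall s V, B V -> V `<=` dom a s -> B (act a s @` V).
Hypothesis Bdom : forall V, B V -> exists s, V `<=` dom a s.
Local Notation fam := (set_family B0 BI).

Definition fam_dom (s : S) : set fam := [set V | famset V `<=` dom a s].

Definition fam_act (s : S) (V : fam) : fam := in_fam B0 BI (act a s @` famset V).

Lemma fam_actE s V : fam_dom s V -> famset (fam_act s V) = act a s @` famset V.
Proof. by move=> sV; rewrite in_famE//; apply: Bact => //; exact: famsetP. Qed.

Lemma fam_act_inj s : {in fam_dom s &, injective (fam_act s)}.
Proof.
move=> V W; rewrite !inE => sV sW /(congr1 (@famset _ _ _ _)).
rewrite !fam_actE// => VW; apply: famset_inj.
by rewrite -(pact_image_inv sV) VW pact_image_inv.
Qed.

Lemma fam_dom_mul s t : fam_dom (s * t) = fam_dom t `&` fam_act t @^-1` fam_dom s.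
Proof.
apply/seteqP; split=> V; rewrite /fam_dom /= dom_mul.
  move=> Vst; have tV : fam_dom t V by move=> x /Vst[].
  by split=> //=; rewrite fam_actE// => _ [x /Vst[_ ?] <-].
move=> [tV /=]; rewrite fam_actE// => sV x Vx; split; first exact: tV.
by apply: sV; exists x.
Qed.

Lemma fam_act_mul s t V : fam_dom (s * t) V ->
  fam_act (s * t) V = fam_act s (fam_act t V).
Proof.
move=> stV; have := stV; rewrite fam_dom_mul => -[tV sV]; apply: famset_inj.
by rewrite !fam_actE// pact_image_mul.
Qed.

Definition fam_partial_action : partial_action S fam :=
  PartialAction fam_act_inj fam_dom_mul fam_act_mul.

Lemma fam_dom_down s V W : (W <= V)%O -> fam_dom s V -> fam_dom s W.
Proof. by move=> /famset_le WV sV; exact: subset_trans sV. Qed.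

Lemma fam_ran_down s V W : (W <= V)%O ->
  ran fam_partial_action s V -> ran fam_partial_action s W.
Proof. by rewrite ran_sinv; exact: fam_dom_down. Qed.

Lemma fam_act_mono s : {in fam_dom s &, {mono fam_act s : V W / (V <= W)%O}}.
Proof.
move=> V W; rewrite !inE => sV sW.
by apply/idP/idP => /famset_le; rewrite ?fam_actE// => VW; apply/famset_le;
  rewrite ?fam_actE//; apply/(pact_image_sub sV sW).
Qed.

Lemma fam_dom0 V : fam_dom szero V -> V = \bot%O.
Proof.
by rewrite /fam_dom /= space_dom0 => V0; apply/fam_eq_bot; rewrite -subset0.
Qed.

Lemma fam_cover V : V <> \bot%O -> exists s, fam_dom s V.
Proof. by move=> _; exact: Bdom (famsetP V). Qed.

Definition fam_action : poset_action S fam :=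
  @PosetAction _ _ _ fam_partial_action fam_dom_down fam_ran_down fam_act_mono
    fam_dom0 fam_cover.

End FamilyAction.

(** * The gaps left by the covers *)

Lemma count_lt (T : eqType) (p q : pred T) (s : seq T) t :
  t \in s -> q t -> ~~ p t -> subpred p q -> (count p s < count q s)%N.
Proof.
move=> ts qt pt pq; elim: s ts => [//|x s IH]; rewrite inE => /orP[/eqP <-|ts] /=.
  by rewrite qt (negbTE pt) add0n add1n ltnS; exact: sub_count.
rewrite -addnS; apply: leq_add; last exact: IH.
by case px : (p x) => //; rewrite (pq _ px).
Qed.

Lemma card_le_setD1 (T : choiceType) (A : set T) t k : A t ->
  (A #<= `I_k.+1)%card -> (A `\` [set t] #<= `I_k)%card.
Proof.
move=> At Ak; have fA : finite_set A by exact: card_le_finite Ak (finite_II _).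
have fA1 : finite_set (A `\` [set t]) by exact: finite_setD.
have /finite_setP[m A1m] := fA1; rewrite (card_le_eql A1m) card_le_II.
rewrite -(card_fset_set A1m) fset_setD1// -ltnS.
have := cardfsD1 t (fset_set A); rewrite in_fset_set// mem_set// add1n => <-.
exact: geq_card_fset_set.
Qed.

Section NextStage.
Variables (S : invSemigroupType) (X : topologicalType).
Variables (a : space_action S X) (d : Order.disp_t).
Variables (E : bMeetSemilatticeType d) (aE : poset_action S E).
Variables (U : E -> set X) (R : E -> set (set E)).
Hypothesis cov : covering a aE U R.
Local Notation meet := Order.meet.
Local Notation aC := (char_action aE).
Implicit Types (e f k : E) (chi psi : character_space E).
Implicit Types (V W Z : set (character_space E)).

(** Finite intersections of gaps. The gaps alone are not closed under
    intersection, since two different covers of [e] give two gaps at [e]. *)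
Inductive gapset : set (character_space E) -> Prop :=
| gapset0 : gapset set0
| gapset_gap e F of R e F : gapset (gap e F)
| gapsetI V W of gapset V & gapset W : gapset (V `&` W).

(** A character containing [k] contains [f] exactly when it contains the meet of
    [k] and [f], so below [k] a cover and its restriction to [k] avoid the same
    characters. *)
Lemma uncovered_down k F F' : same_down F' [set meet k f | f in F] ->
  cyl k `&` uncovered F' = cyl k `&` uncovered F.
Proof.
move=> [F'F FF']; apply/seteqP; split=> chi [ck nF]; split=> // -[f Ff cf];
  apply: nF.
  have [f' F'f' ff'] := FF' (meet k f) (ex_intro2 _ _ f Ff erefl).
  by exists f' => //; apply: char_le ff' _; rewrite char_meet ck.
have [_ [f' F'f' <-] ff'] := F'F f Ff.
by exists f' => //; exact: char_le (le_trans ff' (leIr _ _)) cf.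
Qed.

Lemma gapset_cyl V k : gapset V -> gapset (V `&` cyl k).
Proof.
elim=> [|e F RF|V1 V2 _ IH1 _ IH2]; first by rewrite set0I; exact: gapset0.
  have -> : gap e F `&` cyl k = cyl (meet e k) `&` uncovered F.
    by rewrite /gap setIAC cylI.
  have [->|/eqP ek0] := eqVneq (meet e k) \bot%O.
    by rewrite cyl0 set0I; exact: gapset0.
  have [F' RF' F'F] := cov_down cov RF (leIl e k) ek0.
  by rewrite -(uncovered_down F'F); exact: gapset_gap.
have -> : V1 `&` V2 `&` cyl k = (V1 `&` cyl k) `&` (V2 `&` cyl k).
  by rewrite setIACA setIid.
exact: gapsetI.
Qed.

Lemma gapset_open V : gapset V -> open V.
Proof.
elim=> [|e F RF|V1 V2 _ o1 _ o2]; [exact: open0| |exact: openI].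
by apply: openI; [exact: cyl_open|exact: uncovered_open (cov_finite cov RF)].
Qed.

Lemma gapset_closed V : gapset V -> closed V.
Proof.
elim=> [|e F RF|V1 V2 _ o1 _ o2]; [exact: closed0| |exact: closedI].
by apply: closedI; [exact: cyl_closed|exact: uncovered_closed].
Qed.

Lemma gapset_sub V : gapset V ->
  V = set0 \/ exists e F, R e F /\ V `<=` gap e F.
Proof.
elim=> [|e F RF|V1 V2 _ [->|[e [F [RF sub]]]] _ _]; first by left.
- by right; exists e, F; split.
- by left; rewrite set0I.
- by right; exists e, F; split=> // chi [/sub].
Qed.

Lemma gapset_compact V : gapset V -> compact V.
Proof.
move=> gV; have [->|[e [F [_ sub]]]] := gapset_sub gV; first exact: compact0.
apply: subclosed_compact (gapset_closed gV) (@cyl_compact _ _ e) _.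
by move=> chi /sub[].
Qed.

(** The root [e] is the least [k] with [V `<=` cyl k]. That the least character
    containing [e] lies in [V] plays the part of the independence of a basis. *)
Definition rooted V e := V `<=` cyl e /\ exists e0 : e <> \bot%O, V (principal e0).

Lemma rooted_neq0 V e : rooted V e -> e <> \bot%O.
Proof. by case=> _ []. Qed.

Lemma rooted_principal V e (e0 : e <> \bot%O) : rooted V e -> V (principal e0).
Proof.
by move=> [_ [e0']]; rewrite (Prop_irrelevance e0 e0').
Qed.

Lemma rooted_le V e k : rooted V e -> V `<=` cyl k -> (e <= k)%O.
Proof. by move=> [_ [e0 Ve]] /(_ _ Ve). Qed.

Lemma rooted_uniq V e k : rooted V e -> rooted V k -> e = k.
Proof.
move=> Ve Vk; apply/eqP; rewrite eq_le (rooted_le Ve (proj1 Vk)).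
exact: rooted_le Vk (proj1 Ve).
Qed.

(** If some character contains [e] and avoids [G], no member of [G] is above [e],
    so the least character containing [e] avoids [G] as well. *)
Lemma rootedP e G chi : (cyl e `&` uncovered G) chi ->
  rooted (cyl e `&` uncovered G) e.
Proof.
move=> [ce cG]; split; first by move=> psi [].
exists (char_neq0 ce); split; first exact: principal_cyl.
by move=> [g Gg eg]; apply: cG; exists g => //; exact: char_le eg ce.
Qed.

Lemma gapset_shape V : gapset V -> exists e G, V = cyl e `&` uncovered G.
Proof.
elim=> [|e F RF|V1 V2 _ [e [G ->]] _ [e' [G' ->]]].
- by exists \bot%O, set0; rewrite cyl0 set0I.
- by exists e, F.
- exists (meet e e'), (G `|` G').
  by rewrite cylI setIACA /uncovered bigcup_setU setCU.
Qed.

Lemma gapset_rooted V chi : gapset V -> V chi -> exists e, rooted V e.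
Proof.
by move=> /gapset_shape[e [G ->]] Vc; exists e; exact: rootedP Vc.
Qed.

Lemma rooted_gap V e e' F : rooted V e -> R e' F -> V `<=` cyl e' ->
  exists2 F', R e F' & same_down F' [set meet e f | f in F].
Proof.
by move=> Ve RF Ve'; apply: (cov_down cov RF (rooted_le Ve Ve') (rooted_neq0 Ve)).
Qed.

(** The cover of the root that the gap avoids; it is nontrivial, because the least
    character containing the root lies in the gap. *)
Lemma rooted_cover V e : gapset V -> rooted V e ->
  exists2 F, R e F & V `<=` uncovered F.
Proof.
move=> gV Ve; have [V0|[e' [F [RF sub]]]] := gapset_sub gV.
  by have [_ [e0]] := Ve; rewrite V0.
have [|F' RF' F'F] := rooted_gap Ve RF; first by move=> chi /sub[].
exists F' => // chi Vc; have : (cyl e `&` uncovered F) chi.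
  by split; [exact: (proj1 Ve)|have [] := sub _ Vc].
by rewrite -(uncovered_down F'F) => -[].
Qed.

Lemma rooted_dom V e s : rooted V e -> V `<=` dom aC s -> dom aE s e.
Proof.
move=> Ve Vs; have [l sl el] := Vs _ (rooted_principal (rooted_neq0 Ve) Ve).
exact: poset_dom_down el sl.
Qed.

Lemma cyl_dom s e : dom aE s e -> cyl e `<=` dom aC s.
Proof. by move=> se chi ce; exists e. Qed.

Lemma uncovered_act s e F V : dom aE s e -> (forall f, F f -> (f <= e)%O) ->
  V `<=` cyl e ->
  act aC s @` (V `&` uncovered F) = act aC s @` V `&` uncovered (act aE s @` F).
Proof.
move=> se Fe Ve; have sF f : F f -> dom aE s f.
  by move=> Ff; exact: poset_dom_down (Fe f Ff) se.
apply/seteqP; split=> [_ [chi [Vc nF] <-]|_ [[chi Vc <-] nF]].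
  have sc : dom aC s chi by apply: (cyl_dom se); exact: Ve.
  split; first by exists chi.
  move=> [_ [f Ff <-]]; rewrite /cyl /= (char_act_act sc (sF _ Ff)) => cf.
  by apply: nF; exists f.
have sc : dom aC s chi by apply: (cyl_dom se); exact: Ve.
exists chi => //; split=> // -[f Ff cf]; apply: nF.
by exists (act aE s f); [exists f|rewrite /cyl /= (char_act_act sc (sF _ Ff))].
Qed.

(** An intersection of gaps may lie in the domain of [s] while its factors do not.
    Cutting everything down by a cylinder inside the domain makes the induction
    on the intersection possible. *)
Lemma gapset_act_cyl s k V : dom aE s k -> gapset V ->
  gapset (act aC s @` (V `&` cyl k)).
Proof.
move=> sk; elim=> [|e F RF|V1 V2 _ IH1 _ IH2].
- by rewrite set0I image_set0; exact: gapset0.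
- have := gapset_cyl k (gapset_gap RF).
  have -> : gap e F `&` cyl k = cyl (meet e k) `&` uncovered F.
    by rewrite /gap setIAC cylI.
  have [->|/eqP ek0] := eqVneq (meet e k) \bot%O.
    by rewrite cyl0 set0I image_set0.
  move=> _; have [F' RF' F'F] := cov_down cov RF (leIl e k) ek0.
  have sek : dom aE s (meet e k) by exact: poset_dom_down (leIr _ _) sk.
  rewrite -(uncovered_down F'F) (uncovered_act sek)//; last first.
    by move=> f; exact: (cov_le cov RF').
  rewrite [act aC s @` _](char_act_cyl sek).
  exact/gapset_gap/(cov_invariant cov sek RF').
- have -> : V1 `&` V2 `&` cyl k = (V1 `&` cyl k) `&` (V2 `&` cyl k).
    by rewrite setIACA setIid.
  rewrite pact_imageI; first exact: gapsetI.
    by move=> chi [_ ck]; exact: (cyl_dom sk).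
  by move=> chi [_ ck]; exact: (cyl_dom sk).
Qed.

Lemma gapset_act s V : gapset V -> V `<=` dom aC s -> gapset (act aC s @` V).
Proof.
move=> gV Vs; have [->|/set0P[chi Vc]] := eqVneq V set0.
  by rewrite image_set0; exact: gapset0.
have [e Ve] := gapset_rooted gV Vc; have se := rooted_dom Ve Vs.
by rewrite -(setIidl (proj1 Ve)); exact: gapset_act_cyl.
Qed.

Lemma gapset_dom V : gapset V -> exists s, V `<=` dom aC s.
Proof.
move=> gV; have [->|/set0P[chi Vc]] := eqVneq V set0; first by exists szero.
have [e Ve] := gapset_rooted gV Vc.
have [s se] := poset_cover aE (rooted_neq0 Ve); exists s.
exact: subset_trans (proj1 Ve) (cyl_dom se).
Qed.

Definition gapsetI_closed : setI_closed gapset := gapsetI.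

Local Notation gaps := (set_family gapset0 gapsetI_closed).
Local Notation gap_action :=
  (fam_action gapset0 gapsetI_closed gapset_act gapset_dom).
Local Notation to_gaps := (in_fam gapset0 gapsetI_closed).
Implicit Types (P Q : gaps).

(** A character in [P] either avoids [F] or contains one of its members. When [F]
    covers the root of [P], all these pieces are gaps again. *)
Definition children P F : set gaps :=
  to_gaps (famset P `&` uncovered F) |`
  [set to_gaps (famset P `&` cyl f) | f in F].

Definition gap_covers P : set (set gaps) :=
  [set H | exists e F, [/\ rooted (famset P) e, R e F & H = children P F]].

Lemma children_uncovered P e F : rooted (famset P) e -> R e F ->
  famset (to_gaps (famset P `&` uncovered F)) = famset P `&` uncovered F.
Proof.
move=> Pe RF; rewrite in_famE//.
have -> : famset P `&` uncovered F = famset P `&` gap e F.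
  by rewrite /gap setIA (setIidl (proj1 Pe)).
by apply: gapsetI; [exact: famsetP|exact: gapset_gap].
Qed.

Lemma children_cyl P k :
  famset (to_gaps (famset P `&` cyl k)) = famset P `&` cyl k.
Proof. by rewrite in_famE//; apply: gapset_cyl; exact: famsetP. Qed.

Lemma extent_gaps : extent (@famset _ _ gapset0 gapsetI_closed) = ~` covered R.
Proof.
rewrite /covered setCK; apply/seteqP; split=> [chi [P _ Pc]|chi [[e F] /= RF gc]].
  have [P0|[e [F [RF sub]]]] := gapset_sub (famsetP P).
    by move: Pc; rewrite P0.
  by exists (e, F) => //; exact: sub.
by exists (mk_fam gapset0 gapsetI_closed (gapset_gap RF)).
Qed.

Lemma gaps_rep : representation (@famset _ _ gapset0 gapsetI_closed).
Proof.
split=> // P; split; first exact: gapset_open (famsetP P).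
exact: gapset_compact (famsetP P).
Qed.

Lemma gaps_basis P chi (N : set (character_space E)) :
  famset P chi -> nbhs chi N -> exists Q (H : seq gaps),
    [/\ famset Q chi, {in H, forall h, ~ famset h chi} &
        famset Q `\` \bigcup_(h in [set` H]) famset h `<=` N].
Proof.
move=> Pc /basic_nbhs[e [F [/basicP[ce cF] sub]]].
exists (to_gaps (famset P `&` cyl e)), [seq to_gaps (famset P `&` cyl f) | f <- F].
split; first by rewrite children_cyl.
  by move=> _ /mapP[f fF ->]; rewrite children_cyl => -[_]; exact/negP/cF.
move=> psi [+ nF]; rewrite children_cyl => -[Pp pe]; apply/sub/basicP; split=> //.
move=> f fF; apply/negP => pf; apply: nF.
by exists (to_gaps (famset P `&` cyl f)); [exact: map_f|rewrite children_cyl].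
Qed.

Lemma gaps_dom s : extent (@famset _ _ gapset0 gapsetI_closed) `&` dom aC s =
  \bigcup_(P in dom gap_action s) famset P.
Proof.
apply/seteqP; split=> [chi [[P _ Pc] [l sl cl]]|chi [P Ps Pc]]; last first.
  by split; [exists P|exact: Ps].
exists (to_gaps (famset P `&` cyl l)); last by rewrite children_cyl.
by rewrite /= /fam_dom /= children_cyl => psi [_ pl]; exact: (cyl_dom sl).
Qed.

Lemma gaps_finite P H : gap_covers P H -> finite_set H.
Proof.
move=> [e [F [_ RF ->]]]; rewrite finite_setU; split; first exact: finite_set1.
exact/finite_image/(cov_finite cov RF).
Qed.

Lemma gaps_le P H Q : gap_covers P H -> H Q -> (Q <= P)%O.
Proof.
move=> [e [F [Pe RF ->]]] [->|[f Ff <-]]; apply/famset_le.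
  by rewrite (children_uncovered Pe RF) => chi [].
by rewrite children_cyl => chi [].
Qed.

Lemma gaps_concrete P H : gap_covers P H ->
  concrete (@famset _ _ gapset0 gapsetI_closed) P H.
Proof.
move=> PH; apply/seteqP; split=> [chi Pc|chi [Q HQ]]; last first.
  by have /famset_le := gaps_le PH HQ; exact.
have [e [F [Pe RF ->]]] := PH.
have [[f Ff cf]|nF] := pselect ((\bigcup_(f in F) cyl f) chi).
  exists (to_gaps (famset P `&` cyl f)); last by rewrite children_cyl.
  by right; exists f.
exists (to_gaps (famset P `&` uncovered F)); first by left.
by rewrite (children_uncovered Pe RF).
Qed.

Lemma gaps_down P H Q : gap_covers P H -> (Q <= P)%O -> Q <> \bot%O ->
  exists2 H', gap_covers Q H' & same_down H' [set meet Q h | h in H].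
Proof.
move=> [e [F [Pe RF ->]]] /famset_le QP Q0.
have [chi Qc] : famset Q !=set0.
  by apply/set0P; apply: contra_notN Q0 => /eqP Q0; apply/fam_eq_bot.
have [k Qk] := gapset_rooted (famsetP Q) Qc.
have [F' RF' F'F] := rooted_gap Qk RF (subset_trans QP (proj1 Pe)).
have unc : famset Q `&` uncovered F' = famset Q `&` uncovered F.
  rewrite -(setIidl (proj1 Qk)) -!setIA; congr setI.
  exact: uncovered_down.
have sub_cyl f f' : (meet k f <= f')%O -> famset Q `&` cyl f `<=` cyl f'.
  move=> ff' psi [Qp pf]; apply: char_le ff' _; rewrite char_meet pf andbT.
  exact: (proj1 Qk).
have [F'F1 F'F2] := F'F.
exists (children Q F'); first by exists k, F'.
split=> [_ [->|[f' F'f' <-]]|_ [_ [->|[f Ff <-]] <-]].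
- exists (meet Q (to_gaps (famset P `&` uncovered F))).
    by exists (to_gaps (famset P `&` uncovered F)) => //; left.
  apply/famset_le; rewrite famset_meet (children_uncovered Qk RF').
  rewrite (children_uncovered Pe RF) unc => psi [Qp pF]; split=> //.
  by split=> //; exact: QP.
- have [_ [f Ff <-] f'f] := F'F1 f' F'f'.
  exists (meet Q (to_gaps (famset P `&` cyl f))).
    by exists (to_gaps (famset P `&` cyl f)) => //; right; exists f.
  apply/famset_le; rewrite famset_meet !children_cyl => psi [Qp pf']; split=> //.
  by split; [exact: QP|exact: cyl_le (le_trans f'f (leIr _ _)) _ pf'].
- exists (to_gaps (famset Q `&` uncovered F')); first by left.
  apply/famset_le; rewrite famset_meet (children_uncovered Qk RF') unc.
  by rewrite (children_uncovered Pe RF) => psi [Qp [_ pF]].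
- have [f' F'f' ff'] := F'F2 (meet k f) (ex_intro2 _ _ f Ff erefl).
  exists (to_gaps (famset Q `&` cyl f')); first by right; exists f'.
  apply/famset_le; rewrite famset_meet !children_cyl => psi [Qp [_ pf]].
  by split=> //; apply: sub_cyl ff' _ _.
Qed.

Lemma rooted_act s V e : dom aE s e -> rooted V e ->
  rooted (act aC s @` V) (act aE s e).
Proof.
move=> se Ve; split.
  by rewrite -[cyl _](char_act_cyl se); exact: image_subset (proj1 Ve).
have e0 := rooted_neq0 Ve.
have se0 : act aE s e <> \bot%O by move/(poset_act_eq0 se).
exists se0, (principal e0); first exact: rooted_principal.
apply: (char_act_uniq se); first exact: lexx.
by move=> k sk; exact: poset_act_le.
Qed.

Lemma gaps_invariant : invariant_system gap_action gap_covers.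
Proof.
move=> s P _ Ps [e [F [Pe RF ->]]]; have se := rooted_dom Pe Ps.
have Fe f : F f -> (f <= e)%O by exact: (cov_le cov RF).
have sF f : F f -> dom aE s f by move=> Ff; exact: poset_dom_down (Fe f Ff) se.
have sP : famset (act gap_action s P) = act aC s @` famset P.
  exact: (fam_actE gapset_act).
have sPe : rooted (famset (act gap_action s P)) (act aE s e).
  by rewrite sP; exact: rooted_act.
have sRF := cov_invariant cov se RF.
exists (act aE s e), (act aE s @` F); split=> //.
have act_unc : act gap_action s (to_gaps (famset P `&` uncovered F)) =
    to_gaps (famset (act gap_action s P) `&` uncovered (act aE s @` F)).
  apply: famset_inj; rewrite (children_uncovered sPe sRF) sP.
  rewrite [famset _](fam_actE gapset_act); last first.
    by rewrite /fam_dom /= (children_uncovered Pe RF) => chi [/Ps].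
  by rewrite (children_uncovered Pe RF) (uncovered_act se)//; exact: (proj1 Pe).
have act_cyl f : F f -> act gap_action s (to_gaps (famset P `&` cyl f)) =
    to_gaps (famset (act gap_action s P) `&` cyl (act aE s f)).
  move=> Ff; apply: famset_inj; rewrite children_cyl sP.
  rewrite [famset _](fam_actE gapset_act); last first.
    by rewrite /fam_dom /= children_cyl => chi [/Ps].
  rewrite children_cyl pact_imageI//; last exact: (cyl_dom (sF _ Ff)).
  by rewrite [act aC s @` cyl f](char_act_cyl (sF _ Ff)).
apply/seteqP; split=> [_ [_ [->|[f Ff <-]] <-]|_ [->|[_ [f Ff <-] <-]]].
- by left.
- by right; exists (act aE s f); [exists f|rewrite act_cyl].
- by exists (to_gaps (famset P `&` uncovered F)) => //; left.
- exists (to_gaps (famset P `&` cyl f)); first by right; exists f.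
  by rewrite act_cyl.
Qed.

(** The finite list [ts] contains the conditions from which [V] is built. If [Z]
    is not contained in [V], the failure is due to a single gap around the given
    point of [V], and that gap is expressed through conditions in [ts]. *)
Definition tested_by V (ts : seq (set (character_space E))) :=
  forall chi Z, V chi -> ~ Z `<=` V -> exists e F,
    [/\ R e F, gap e F chi, uncovered F \in ts,
        forall f, F f -> cyl f \in ts & ~ Z `<=` gap e F].

Lemma tested_by_sub V (ts us : seq (set (character_space E))) :
  {subset ts <= us} -> tested_by V ts -> tested_by V us.
Proof.
move=> tu tV chi Z Vc ZV; have [e [F [RF gc uF cF ZF]]] := tV chi Z Vc ZV.
by exists e, F; split=> //; [exact: tu|move=> f /cF; exact: tu].
Qed.

Lemma gapset_tests V : gapset V -> exists ts, tested_by V ts.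
Proof.
elim=> [|e F RF|V1 V2 _ [ts1 t1] _ [ts2 t2]]; first by exists [::].
  have /finite_seqP[s sF] := cov_finite cov RF.
  exists (uncovered F :: map (@cyl _ E) s) => chi Z gc ZF.
  exists e, F; split=> //; first exact: mem_head.
  by move=> f; rewrite {1}sF => /= fs; rewrite inE map_f// orbT.
exists (ts1 ++ ts2) => chi Z [c1 c2] Z12.
have [Z1|Z1] := pselect (Z `<=` V1).
  have Z2 : ~ Z `<=` V2.
    by move=> Z2; apply: Z12 => psi Zp; split; [exact: Z1|exact: Z2].
  have t12 : tested_by V2 (ts1 ++ ts2).
    by apply: tested_by_sub t2 => t; rewrite mem_cat orbC => ->.
  exact: t12 c2 Z2.
have t12 : tested_by V1 (ts1 ++ ts2).
  by apply: tested_by_sub t1 => t; rewrite mem_cat => ->.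
exact: t12 c1 Z1.
Qed.

Lemma gaps_tests (s : seq gaps) : exists ts,
  forall Q, Q \in s -> tested_by (famset Q) ts.
Proof.
elim: s => [|P s [ts tsP]]; first by exists [::].
have [us usP] := gapset_tests (famsetP P); exists (us ++ ts) => Q.
rewrite inE => /orP[/eqP ->|/tsP tQ].
  by apply: tested_by_sub usP => t; rewrite mem_cat => ->.
by apply: tested_by_sub tQ => t; rewrite mem_cat orbC => ->.
Qed.

(** Each division along a cover defining the chosen [Q] produces pieces that satisfy
    a condition in [ts] which [P] violates: the piece avoiding the cover
    satisfies [uncovered F], and a piece containing a member below [f] lies in
    [cyl f], while the root of [P] avoids [F]. The number of violated conditions
    bounds the depth of the tree. *)
Lemma gaps_thorough P (s : seq gaps) :
  famset P `<=` \bigcup_(Q in [set` s]) famset Q ->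
  refines gap_covers (below s) P.
Proof.
have [ts tsP] := gaps_tests s.
pose open_tests (Q : gaps) := count (fun t => `[< ~ famset Q `<=` t >]) ts.
have [n] := ubnP (open_tests P); elim: n P => // n IH P Pn Ps.
have [->|/eqP P0] := eqVneq P \bot%O; first by apply: refines_leaf; left.
have [chi Pc] : famset P !=set0.
  by apply/set0P; apply: contra_notN P0 => /eqP P0; apply/fam_eq_bot.
have [e Pe] := gapset_rooted (famsetP P) Pc.
have [_ [e0 Pp]] := Pe.
have [Q /= Qs Qp] := Ps _ Pp.
have [PQ|PQ] := pselect (famset P `<=` famset Q).
  by apply: refines_leaf; right; exists Q => //; apply/famset_le.
have [e' [F [RF [ee' pF] uF cF PF]]] := tsP Q Qs _ _ Qp PQ.
have Pe' : famset P `<=` cyl e' by exact: subset_trans (proj1 Pe) (cyl_le ee').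
have [F' RF' F'F] := rooted_gap Pe RF Pe'.
have PH : gap_covers P (children P F') by exists e, F'.
have descend Q' t : (Q' <= P)%O -> t \in ts -> famset Q' `<=` t ->
    ~ famset P `<=` t -> refines gap_covers (below s) Q'.
  move=> /famset_le Q'P tts Q't Pt; apply: IH; last exact: subset_trans Ps.
  rewrite -ltnS; apply: leq_trans Pn; rewrite ltnS.
  apply: (count_lt tts); first exact/asboolP.
    by apply/negP => /asboolP.
  move=> u /asboolP Q'u; apply/asboolP => Pu; apply: Q'u.
  exact: subset_trans Pu.
apply: (refines_cover PH) => Q' PQ'; have Q'P := gaps_le PH PQ'.
case: PQ' => [Q'E|[f' F'f' Q'E]].
  apply: (descend Q' (uncovered F)) => //.
    rewrite Q'E (children_uncovered Pe RF') => psi [Pp' pF'].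
    have : (cyl e `&` uncovered F') psi by split=> //; exact: (proj1 Pe).
    by rewrite (uncovered_down F'F) => -[].
  by move=> PuF; apply: PF => psi Pp'; split; [exact: Pe'|exact: PuF].
have [F'F1 _] := F'F; have [_ [f Ff <-] f'f] := F'F1 f' F'f'.
apply: (descend Q' (cyl f)) => //; first exact: cF.
  rewrite -Q'E children_cyl => psi [_]; apply: cyl_le.
  exact: le_trans f'f (leIr _ _).
by move=> /(_ _ Pp) ef; apply: pF; exists f.
Qed.

(** The characters that are not covered form the union of the gaps, and the
    covers in [R] of the roots are inherited by the gaps. So the situation at the
    start is reproduced on the open half of the space of characters. *)
Lemma next_covering :
  covering aC gap_action (@famset _ _ gapset0 gapsetI_closed) gap_covers.
Proof.
split.
- exact: char_hausdorff.
- exact: gaps_rep.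
- exact: gaps_basis.
- exact: gaps_dom.
- by move=> s P Ps; rewrite [RHS](fam_actE gapset_act).
- exact: gaps_finite.
- exact: gaps_le.
- by move=> P H Q PH QP Q0; exact: gaps_down PH QP Q0.
- exact: gaps_concrete.
- exact: gaps_invariant.
- exact: gaps_thorough.
Qed.

(** A gap avoids some nontrivial cover [F0] of its root. Dividing the gap along
    [F0] returns the whole gap, so that [F0] gives a trivial cover, and trivial
    covers of the root also give trivial covers of the gap. *)
Lemma next_nontrivial (k : nat) :
  (forall e, (nontrivial_covers R e #<= `I_k.+1)%card) ->
  forall P, (nontrivial_covers gap_covers P #<= `I_k)%card.
Proof.
move=> Rk P; have [P0|/set0P[chi Pc]] := eqVneq (famset P) set0.
  suff -> : nontrivial_covers gap_covers P = set0 by [].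
  by rewrite -subset0 => H [[e [F [[_ [e0]]]]]]; rewrite P0.
have [e Pe] := gapset_rooted (famsetP P) Pc.
have [F0 RF0 PF0] := rooted_cover (famsetP P) Pe.
have F0e : ~ F0 e.
  have [_ [e0 Pp]] := Pe; move=> F0e; apply: PF0 Pp _.
  by exists e => //; exact: principal_cyl.
apply: card_le_trans (card_le_setD1 (conj RF0 F0e) (Rk e)).
apply: card_le_trans (card_image_le (children P) _).
apply: subset_card_le => _ [[e' [F [Pe' RF ->]]] nP].
have ? := rooted_uniq Pe Pe'; subst e'; exists F => //; split; first split=> //.
  move=> Fe; apply: nP; right; exists e => //; apply: famset_inj.
  by rewrite children_cyl; apply: setIidl; exact: (proj1 Pe).
move=> FF0; apply: nP; left; apply: famset_inj; rewrite (children_uncovered Pe RF).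
by rewrite FF0; apply/esym/setIidl.
Qed.

(** The root of a nonempty gap has a nontrivial cover. *)
Lemma next_empty : (forall e, (nontrivial_covers R e #<= `I_0)%card) ->
  forall chi : character_space gaps, False.
Proof.
move=> R0 chi; have [[P cP] _ _] := char_spaceP chi.
apply: (char_neq0 cP); apply/fam_eq_bot; apply/eqP/negPn/negP => /set0P[psi Pp].
have [e Pe] := gapset_rooted (famsetP P) Pp.
have [F RF PF] := rooted_cover (famsetP P) Pe.
have := R0 e; rewrite II0 card_le0 => /eqP nt0.
suff : nontrivial_covers R e F by rewrite nt0.
split=> // Fe; have [_ [e0 Pp0]] := Pe; apply: PF Pp0 _.
by exists e => //; exact: principal_cyl.
Qed.

End NextStage.

(** * The initial covering *)

Lemma finite_maximal (d : Order.disp_t) (L : porderType d) (A : set L) x :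
  finite_set A -> A x -> exists2 m, maximals A m & (x <= m)%O.
Proof.
move=> /finite_seqP[s ->] xs.
pose up y := count (fun z => (y < z)%O) s.
have [n] := ubnP (up x); elim: n x xs => // n IH x xs xn.
have [mx|nmx] := pselect (maximals [set` s] x); first by exists x => //; exact: lexx.
have [y [ys xy yx]] : exists y, [/\ y \in s, (x <= y)%O & y <> x].
  apply: contrapT => H; apply: nmx; split=> // y ys xy; apply: contrapT => yx.
  by apply: H; exists y.
have ltxy : (x < y)%O by rewrite lt_neqAle xy andbT eq_sym; apply/eqP.
have [|m mP ym] := IH y ys; last by exists m => //; exact: le_trans xy ym.
rewrite ltnS in xn; apply: leq_trans xn; apply: (count_lt ys ltxy).
  by rewrite ltxx.
by move=> z; exact: lt_trans.
Qed.

Section InitialStage.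
Variables (S : invSemigroupType) (X : topologicalType)
  (aX : space_action S X) (d : Order.disp_t) (E : bMeetSemilatticeType d)
  (aE : poset_action S E) (U : E -> set X) (R : E -> set (set E)).
Hypotheses (tX : tdlch X) (repU : representation U) (genU : generating U).
Hypothesis eqvU : equivariant aX aE U.
Hypotheses (sysR : cover_system R) (conR : forall e F, R e F -> concrete U e F).
Hypotheses (invR : invariant_system aE R) (thR : thorough U R).
Local Notation meet := Order.meet.

Lemma equivariant_extent : extent U = setT.
Proof.
apply/seteqP; split=> // x _; have [s sx] := space_cover aX x.
have [domE _] := eqvU s; move: sx; rewrite domE => -[e _ Ue]; by exists e.
Qed.

(** The tree is built from its leaves, by induction on the number of levels that
    remain below a chain. *)
Lemma thorough_refines e (s : seq E) :
  U e `<=` \bigcup_(i in [set` s]) U i -> refines R (below s) e.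
Proof.
(* The family in [thorough] is nonempty; [\bot] makes it so. *)
move=> es; pose t := \bot%O :: s.
have : U e `<=` \bigcup_(i : 'I_(size s).+1) U (nth \bot%O t i).
  move=> x /es[i /= is_ Ui].
  have it : (index i t < (size s).+1)%N by rewrite index_mem inE is_ orbT.
  by exists (Ordinal it) => //=; rewrite nth_index// inE is_ orbT.
move=> /thR[N [F [N0 FR Fend]]].
suff H m fs : (size fs + m = N)%N -> cover_chain F e fs ->
    refines R (below s) (last e fs) by exact: (H N [::]).
elim: m fs => [|m IH] fs.
  rewrite addn0 => fsN /(Fend _ fsN)[i lei]; apply: refines_leaf.
  have := mem_nth \bot%O (ltn_ord i : (i < size t)%N); rewrite inE => /orP[/eqP ei|si].
    by left; apply/eqP; rewrite -lex0 -ei.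
  by right; exists (nth \bot%O t i).
move=> fsN Ffs; have fs_lt : (size fs < N)%N by rewrite -fsN addnS ltnS leq_addr.
apply: (refines_cover (FR fs fs_lt Ffs)) => f Ff.
rewrite -(last_rcons e fs f); apply: IH; first by rewrite size_rcons addSnnS.
move=> j; rewrite size_rcons ltnS leq_eqVlt => /orP[/eqP ->|jfs].
  by rewrite nth_rcons ltnn eqxx -cats1 take_cat ltnn subnn take0 cats0.
by rewrite nth_rcons jfs -cats1 take_cat jfs; exact: Ffs.
Qed.

Lemma cover_down_same e F k : R e F ->
  same_down (cover_down k F) [set meet k f | f in F].
Proof.
move=> RF; have [fc _ _] := sysR; have [fF _ _] := fc _ _ RF.
split=> f; first by move=> [kf _]; exists f => //; exact: lexx.
exact/finite_maximal/finite_image.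
Qed.

(** The sets that are clopen for the topology spanned by the differences of [U e]
    and finite unions of sets [U f] form a boolean algebra containing all [U e], so
    every compact open set is of this kind. *)
Lemma generating_basis e x N : U e x -> nbhs x N -> exists e' (F : seq E),
  [/\ U e' x, {in F, forall f, ~ U f x} &
      U e' `\` \bigcup_(f in [set` F]) U f `<=` N].
Proof.
move=> _ /(tdlch_basis tX)[V [oV cV Vx VN]].
have [_ U0 UI] := repU.
pose B e' (F : seq E) := U e' `\` \bigcup_(f in [set` F]) U f.
pose M (W : set X) := forall y, exists e' F, B e' F y /\
  (B e' F `<=` W \/ B e' F `<=` ~` W).
have M2 W W' Z : M W -> M W' -> (forall D : set X,
    (D `<=` W \/ D `<=` ~` W) -> (D `<=` W' \/ D `<=` ~` W') ->
    D `<=` Z \/ D `<=` ~` Z) -> M Z.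
  move=> MW MW' H y; have [e1 [F1 [[y1 nF1] s1]]] := MW y.
  have [e2 [F2 [[y2 nF2] s2]]] := MW' y; exists (meet e1 e2), (F1 ++ F2).
  have BE : B (meet e1 e2) (F1 ++ F2) = B e1 F1 `&` B e2 F2.
    apply/seteqP; split=> z.
      rewrite /B UI => -[[z1 z2] nF]; split; split=> // -[f /= fF Uf];
      by apply: nF; exists f => //=; rewrite mem_cat fF ?orbT.
    rewrite /B UI => -[[z1 nF] [z2 nF']]; split=> // -[f /=].
    by rewrite mem_cat => /orP[fF|fF] Uf; [apply: nF|apply: nF']; exists f.
  rewrite BE; split; first by split; split.
  apply: H.
    by case: s1 => s1; [left|right] => z [/s1].
  by case: s2 => s2; [left|right] => z [_ /s2].
have : M V.
  have : cpt_opens V by [].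
  rewrite -genU => /(_ M); apply; split; last first.
    move=> _ [f _ <-] y; have [e0 _ Ue0] : extent U y by rewrite equivariant_extent.
    have [Uf|Uf] := pselect (U f y).
      exists f, [::]; split; first by split=> // -[].
      by left => z [].
    exists e0, [:: f]; split.
      by split=> // -[g /=]; rewrite inE => /eqP ->.
    by right => z [_ nF] Uf'; apply: nF; exists f => //=; rewrite inE.
  split; first split.
  - move=> y; have [e0 _ Ue0] : extent U y by rewrite equivariant_extent.
    by exists e0, [::]; split; [split=> // -[]|right => z _ []].
  - move=> W W' MW MW'; apply: (M2 _ _ _ MW MW') => D [DW|DW] [DW'|DW'].
    + by left => z /DW; left.
    + by left => z /DW; left.
    + by left => z /DW'; right.
    + by right => z Dz [/(DW _ Dz)|/(DW' _ Dz)].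
  - move=> W W' MW MW' _; apply: (M2 _ _ _ MW MW') => D [DW|DW] [DW'|DW'].
    + by right => z /DW' W'z [].
    + by left => z Dz; split; [exact: DW|exact: DW'].
    + by right => z /DW Wz [].
    + by right => z /DW Wz [].
move=> /(_ x)[e' [F [[Ux nF] sub]]]; exists e', F; split=> //.
  by move=> f fF Uf; apply: nF; exists f.
case: sub => sub; first exact: subset_trans VN.
by have := sub x (conj Ux nF).
Qed.

Lemma initial_covering : covering aX aE U R.
Proof.
have [fc _ down] := sysR.
split=> //.
- by have [] := tX.
- exact: generating_basis.
- by move=> s; rewrite -/(extent U) equivariant_extent setTI; have [] := eqvU s.
- by move=> s; have [] := eqvU s.
- by move=> e F /fc[].
- by move=> e F f /fc[_ + _]; exact.
- move=> e F k RF ke _; exists (cover_down k F); first exact: down RF ke.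
  exact: cover_down_same RF.
- exact: thorough_refines.
Qed.

End InitialStage.

(** * The tower of coverings *)

Section Tower.
Variable S : invSemigroupType.

Record stage := Stage {
  st_space : topologicalType;
  st_action : space_action S st_space;
  st_disp : Order.disp_t;
  st_lattice : bMeetSemilatticeType st_disp;
  st_lattice_action : poset_action S st_lattice;
  st_rep : st_lattice -> set st_space;
  st_covers : st_lattice -> set (set st_lattice);
  st_cov : covering st_action st_lattice_action st_rep st_covers
}.

Definition next_stage (st : stage) : stage := Stage (next_covering (st_cov st)).

Variable st0 : stage.

Fixpoint tower (k : nat) : stage :=
  if k is j.+1 then next_stage (tower j) else st0.

Definition tower_space k : topologicalType := character_space (st_lattice (tower k)).

Definition tower_action k : space_action S (tower_space k) :=
  char_action (st_lattice_action (tower k)).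

Lemma tower_extent k :
  extent (@st_rep (tower k.+1)) = ~` covered (@st_covers (tower k)).
Proof. exact: extent_gaps. Qed.

Lemma isomorphic_refl G : isomorphic G G.
Proof.
have hid (T : topologicalType) : homeomorphism (@id T).
  have cid : continuous (@id T) by move=> x N.
  by split=> //; exists id; split.
by exists id, id; split.
Qed.

Lemma tower_resolution : tdlch (st_space st0) -> extent (@st_rep st0) = setT ->
  independent_resolution (germ_groupoid (st_action st0))
    (fun k => germ_groupoid (tower_action k)).
Proof.
move=> t0 e0; split.
- exact: germ_ample.
- by move=> k; apply: germ_ample; exact: char_tdlch.
- exists (fun k => covered (@st_covers (tower k))),
    (fun k => ~` covered (@st_covers (tower k))); split.
  + move=> k; split; first exact: covered_closed (st_cov (tower k)).
    exact: covered_ginvariant (st_cov (tower k)).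
  + by move=> k; split; [exact: setUv|exact: setICr].
  + by rewrite -e0; exact: covered_iso (st_cov st0).
  + move=> k; rewrite -tower_extent; exact: covered_iso (st_cov (tower k.+1)).
- move=> k; exists S, (st_disp (tower k)), (st_lattice (tower k)),
    (st_lattice_action (tower k)), (tower_action k); split.
  + exact: semilattice_weak.
  + exact: semilattice_locally_finite.
  + exact: char_action_induced.
  + exact: isomorphic_refl.
Qed.

Lemma tower_nontrivial k :
  (forall e, (nontrivial_covers (@st_covers st0) e #<= `I_k)%card) ->
  forall j, (j <= k)%N ->
  forall e, (nontrivial_covers (@st_covers (tower j)) e #<= `I_(k - j))%card.
Proof.
move=> Rk; elim=> [|j IH] jk; first by rewrite subn0.
apply: (next_nontrivial (st_cov (tower j))) => e.
by rewrite subnSK//; exact: IH (ltnW jk) e.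
Qed.

Lemma tower_empty k :
  (forall e, (nontrivial_covers (@st_covers st0) e #<= `I_k)%card) ->
  [set: garr (germ_groupoid (tower_action k.+1))] = set0.
Proof.
move=> Rk; rewrite -subset0 => g _.
apply: (next_empty (st_cov (tower k))) (germ_src g) => e.
by have := tower_nontrivial Rk (leqnn k) e; rewrite subnn.
Qed.

End Tower.

Theorem theorem2 (S : invSemigroupType) (X : topologicalType)
    (aX : space_action S X) (d : Order.disp_t) (E : bMeetSemilatticeType d)
    (aE : poset_action S E) (U : E -> set X) (R : E -> set (set E)) :
  tdlch X ->
  representation U -> generating U -> equivariant aX aE U ->
  cover_system R -> (forall e F, R e F -> concrete U e F) ->
  invariant_system aE R -> thorough U R ->
  exists (Xs : nat -> topologicalType) (a : forall k, space_action S (Xs k)),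
    [/\ forall k, tdlch (Xs k),
        independent_resolution (germ_groupoid aX)
          (fun k => germ_groupoid (a k)),
        forall k, exists B : set (set (Xs k)),
          regular_basis B /\ invariant_basis (a k) B &
        forall k : nat, (forall e : E, nontrivial_covers R e #<= `I_k) ->
          [set: garr (germ_groupoid (a k.+1))] = set0].
Proof.
move=> tX repU genU eqvU sysR conR invR thR.
pose st0 := Stage (initial_covering tX repU genU eqvU sysR conR invR thR).
exists (tower_space st0), (tower_action st0); split.
- by move=> k; exact: char_tdlch.
- by apply: (tower_resolution (st0 := st0)) => //; exact: equivariant_extent eqvU.
- move=> k; exists (@cyls _ (st_lattice (tower st0 k))).
  by split; [exact: cyls_regular|exact: cyls_invariant].
- by move=> k Rk; exact: (tower_empty (st0 := st0)).
Qed.
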